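(* Let $k\ge 3$ be an odd integer and let $G$ be a finite group of even order with $\gcd(k,|G|)=1$. Then there are infinitely many integers $v$ for which there exists a $2$-$(v,k,1)$-design whose automorphism group has a subgroup isomorphic to $G$.
   Context: A $2$-$(v,k,1)$-design consists of a set of $v$ points together with a collection of $k$-element subsets of the points (called blocks) such that any two distinct points lie in exactly one block. An automorphism is a permutation of the points mapping the set of blocks onto itself. *)

(* Defs.v *)
From HB Require Import structures.
From mathcomp Require Import all_boot all_fingroup.

Set Implicit Arguments.
Unset Strict Implicit.
Unset Printing Implicit Defensive.

(* Blocks form a set rather than a multiset: for k >= 2 the condition that two
   distinct points lie in exactly one block rules out repeated blocks. *)
Definition is_design (T : finType) (v k : nat) (Bs : {set {set T}}) : Prop :=
  [/\ #|T| = v,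
      forall B : {set T}, B \in Bs -> #|B| = k
    & forall x y : T, x != y ->
        exists! B : {set T}, [/\ B \in Bs, x \in B & y \in B]].

Definition design_aut (T : finType) (Bs : {set {set T}}) : {set {perm T}} :=
  [set s : {perm T} | [set s @: (B : {set T}) | B in Bs] == Bs].

Lemma design_aut_group_set (T : finType) (Bs : {set {set T}}) :
  group_set (design_aut Bs).
Proof.
apply/group_setP; split=> [|s t].
  rewrite inE; apply/eqP; rewrite -[RHS]imset_id; apply: eq_imset => B /=.
  by rewrite -[RHS]imset_id; apply: eq_imset => x; rewrite perm1.
rewrite !inE => /eqP Hs /eqP Ht; apply/eqP.
rewrite -[RHS]Ht -[in RHS]Hs -imset_comp; apply: eq_imset => B /=.
by rewrite -imset_comp; apply: eq_imset => x; rewrite permM.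
Qed.

Canonical design_aut_group (T : finType) (Bs : {set {set T}}) :=
  Group (design_aut_group_set Bs).

(* Main.v *)
Require Import Defs.
From HB Require Import structures.
From mathcomp Require Import all_boot all_order all_algebra all_fingroup all_solvable all_field.
From mathcomp Require Import ring zify.

Set Implicit Arguments.
Unset Strict Implicit.
Unset Printing Implicit Defensive.
Import GRing.Theory Num.Theory Order.TTheory.
Local Open Scope ring_scope.

(* Write k = 2w + 1.  The points are the pairs (v, y) in V x F, with F and K large finite fields and
   V = K^G; the group permutes the coordinates of V and fixes F.  All blocks are translates of the
   blocks of a G-invariant difference family.  Its blocks inside {0} x F come from a cyclotomic
   difference family of F; the others are {(x_i d, l y_i)} with d in V \ 0 and l in F^* subject to
   col d = tau l, where tau embeds F^* in K^* and col : V \ 0 -> K^* is G-invariant and homogeneous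
   of degree M.  Such blocks cover each difference once as soon as the colours
   (x_j - x_i)^M / tau (y_j - y_i) of the base blocks take each value in the group of
   (|K| - 1)/M-th roots of unity once.

   An involution of G may exchange two points of V x {y}, so the block through them must be
   invariant; for this reason there are k symmetric base blocks {(0, 0)} U {(a_p, b_p), (-a_p, b_p)}.
   The a_p are chosen greedily so that all colours involved are distinct: every constraint
   excludes at most M of the M (|F| - 1) admissible values of a_p.  The colours which remain are
   distributed over blocks with distinct y_i, and a second moment argument provides x_i in K
   whose differences have these prescribed colours. *)

(** * Prescribing the power residue classes of differences *)

Lemma card_root_set (K : finFieldType) (M : nat) (y : K) :
  (0 < M)%N -> (#|[set x : K | x ^+ M == y]| <= M)%N.
Proof.
move=> M0; rewrite cardE.
have nz : 'X^M - y%:P != 0 :> {poly K} by rewrite -size_poly_eq0 size_XnsubC.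
have := @max_poly_roots _ ('X^M - y%:P) (enum [set x : K | x ^+ M == y]) nz.
rewrite size_XnsubC // ltnS; apply; last exact: enum_uniq.
by apply/allP=> x; rewrite mem_enum inE rootE !hornerE subr_eq0.
Qed.

Lemma expf_card_pred (K : finFieldType) (x : K) : x != 0 -> x ^+ #|K|.-1 = 1.
Proof.
move=> nz; apply: (mulfI nz); rewrite -exprS prednK ?mulr1 ?expf_card //.
exact: ltnW (finNzRing_gt1 K).
Qed.

Lemma card_pred_factors_gt0 (K : finFieldType) (M N : nat) :
  (M * N)%N = #|K|.-1 -> (0 < M)%N /\ (0 < N)%N.
Proof.
move=> MN; apply/andP; rewrite -muln_gt0 MN.
by have := finNzRing_gt1 K; case: #|K| => [|[]].
Qed.

Lemma root_of_unity_neq0 (K : fieldType) (s : nat) (x : K) : (0 < s)%N -> x ^+ s = 1 -> x != 0.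
Proof.
move=> s0; apply: contra_eq_neq => ->.
by rewrite expr0n eqn0Ngt s0 eq_sym oner_neq0.
Qed.

(** The M N nonzero elements split into the fibres of x |-> x^M over the N-th roots of unity. There
    are at most N fibres of at most M elements each, so all these bounds are attained. *)
Lemma card_fiber (K : finFieldType) (M N : nat) (y : K) :
  (M * N)%N = #|K|.-1 -> y ^+ N = 1 -> #|[set x : K | x ^+ M == y]| = M.
Proof.
move=> MN y1; have [M0 N0] := card_pred_factors_gt0 MN.
set U := [set z : K | z ^+ N == 1].
have E : (\sum_(z in U) #|[set x : K | x ^+ M == z]| = M * N)%N.
  rewrite MN -(cardC1 (0 : K)) -sum1_card.
  rewrite [RHS](partition_big (fun x : K => x ^+ M) (mem U)) /=; last first.
    move=> x nx; rewrite inE -exprM MN expf_card_pred //.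
  apply: eq_bigr => z; rewrite inE => /eqP z1.
  rewrite -sum1_card; apply: eq_bigl => x; rewrite !inE andb_idl // => /eqP xz.
  apply/eqP=> x0; move: z1; rewrite -xz x0 !expr0n eqn0Ngt M0 /= expr0n eqn0Ngt N0.
  by move/eqP; rewrite eq_sym oner_eq0.
have yU : y \in U by rewrite inE y1.
have cU : (#|U| <= N)%N by exact: card_root_set.
apply/eqP; rewrite eqn_leq card_root_set //= leqNgt; apply/negP=> lt.
have : (\sum_(z in U) #|[set x : K | x ^+ M == z]| < \sum_(z in U) M)%N.
  rewrite (bigD1 y) //= [X in (_ < X)%N](bigD1 y) //= -addSn.
  by apply: leq_add => //; apply: leq_sum => z _; apply: card_root_set.
by rewrite E sum_nat_const mulnC ltn_pmul2r // ltnNge cU.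
Qed.

(* The injection is x |-> (x - a) / (x - b), which avoids 1. *)
Lemma card_mobius_fiber (K : finFieldType) (M : nat) (a b y : K) : a != b ->
  (#|[set x : K | (x != b) && (((x - a) / (x - b)) ^+ M == y)]|
     <= #|[set z : K | (z != 1%R) && (z ^+ M == y)]|)%N.
Proof.
move=> ab.
have inj : {in [set x : K | (x != b) && (((x - a) / (x - b)) ^+ M == y)] &,
    injective (fun x => (x - a) / (x - b))}.
  move=> x x'; rewrite !inE => /andP[xb _] /andP[x'b _] /eqP.
  rewrite eqr_div ?subr_eq0 // -subr_eq0.
  have -> : (x - a) * (x' - b) - (x' - a) * (x - b) = (x - x') * (a - b) by ring.
  by rewrite mulf_eq0 !subr_eq0 (negPf ab) orbF => /eqP.
rewrite -(card_in_imset inj); apply/subset_leq_card/subsetP=> z /imsetP[x].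
rewrite !inE => /andP[xb /eqP <-] ->; rewrite eqxx andbT.
apply/eqP=> /divr1_eq /addrI /oppr_inj; exact/eqP.
Qed.

(** * Moments of the number of elements of a set in a given class around c *)

Section Moments.
Variables (K : finFieldType) (M N : nat).
Hypothesis MN : (M * N)%N = #|K|.-1.
Let q := #|K|.
Let U := [set z : K | z ^+ N == 1].
Let f (X : {set K}) (y c : K) := #|[set x in X | (x - c) ^+ M == y]|.

Let M_gt0 : (0 < M)%N := (card_pred_factors_gt0 MN).1.
Let N_gt0 : (0 < N)%N := (card_pred_factors_gt0 MN).2.

Lemma expM_mem_roots (x : K) : (x ^+ M \in U) = (x != 0).
Proof.
rewrite inE -exprM MN; have [->|nz] := eqVneq x 0; last by rewrite expf_card_pred ?eqxx.
by rewrite -MN expr0n eqn0Ngt muln_gt0 M_gt0 N_gt0 eq_sym oner_eq0.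
Qed.

Lemma card_roots_of_unity : #|U| = N.
Proof. by apply: (@card_fiber K N M); rewrite ?expr1n // mulnC. Qed.

Lemma card_near_sum X y c : f X y c = (\sum_(x in X) ((x - c) ^+ M == y))%N.
Proof.
by rewrite /f -sum1_card; under eq_bigl do rewrite inE; rewrite big_mkcondr.
Qed.

(** A pair (x, c) with x != c is counted for the single class (x - c)^M, a pair with x = c for
    none. *)
Lemma first_moment X : (\sum_(y in U) \sum_c f X y c = #|X| * (q - 1))%N.
Proof.
rewrite exchange_big /=; under eq_bigr do under eq_bigr do rewrite card_near_sum.
under eq_bigr do rewrite exchange_big /=.
rewrite exchange_big /= -sum_nat_const; apply: eq_bigr => x xX.
rewrite subn1 -(cardC1 x) -sum1_card [RHS]big_mkcond /= ; apply: eq_bigr => c _.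
rewrite !inE -subr_eq0 -opprB oppr_eq0; case: ifP => [nz|/negbFE/eqP z].
  rewrite (bigD1 ((x - c) ^+ M)) ?expM_mem_roots //= eqxx big1 // => y /andP[_].
  by rewrite eq_sym => /negPf ->.
rewrite big1 // => y; case: eqP => // <-; by rewrite expM_mem_roots z eqxx.
Qed.

(* Summing over all classes y makes this computable: x - c and x' - c lie in the same class if and
   only if c is sent to an M-th root of unity by the injection of [card_mobius_fiber]. *)
Lemma second_moment X :
  (\sum_(y in U) \sum_c f X y c ^ 2 <= #|X| * (q - 1) + #|X| * (#|X| - 1) * (M - 1))%N.
Proof.
have -> : (\sum_(y in U) \sum_c f X y c ^ 2 =
  \sum_(x in X) \sum_(x' in X) \sum_c \sum_(y in U)
     ((x - c) ^+ M == y) * ((x' - c) ^+ M == y))%N.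
  rewrite exchange_big /=.
  under eq_bigr => c _ do under eq_bigr => y _ do
    (rewrite card_near_sum -mulnn big_distrl /=; under eq_bigr do rewrite big_distrr).
  under eq_bigr => c _ do rewrite exchange_big /=.
  rewrite exchange_big /=; apply: eq_bigr => x _.
  under eq_bigr => c _ do rewrite exchange_big /=.
  by rewrite exchange_big.
have -> : (#|X| * (q - 1) + #|X| * (#|X| - 1) * (M - 1) =
  \sum_(x in X) ((q - 1) + (#|X| - 1) * (M - 1)))%N by rewrite sum_nat_const mulnDr mulnA.
apply: leq_sum => x xX; rewrite (bigD1 x) //=; apply: leq_add.
  rewrite subn1 -(cardC1 x) -[leqRHS]sum1_card [leqRHS]big_mkcond /=; apply: leq_sum => c _.
  rewrite inE -subr_eq0 -opprB oppr_eq0; case: ifP => [nz|/negbFE/eqP z].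
    rewrite (bigD1 ((x - c) ^+ M)) ?expM_mem_roots //= eqxx big1 // => y /andP[_].
    by rewrite eq_sym => /negPf ->.
  rewrite big1 // => y; case: eqP => // <-; by rewrite expM_mem_roots z eqxx.
have -> : (#|X| - 1 = #|X :\ x|)%N by rewrite (cardsD1 x X) xX addnC addnK.
rewrite -sum_nat_const; under eq_bigl do rewrite andbC -in_setD1.
apply: leq_sum => x'; rewrite !inE => /andP[nx _].
have E : #|[set z : K | (z != 1) && (z ^+ M == 1)]| = (M - 1)%N.
  have <- : [set z : K | z ^+ M == 1] :\ 1 = [set z : K | (z != 1) && (z ^+ M == 1)].
    by apply/setP=> z; rewrite !inE.
  have := cardsD1 1 [set z : K | z ^+ M == 1].
  by rewrite (card_fiber MN) ?expr1n // inE expr1n eqxx => {2}->; rewrite addKn.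
rewrite -E; apply: leq_trans (card_mobius_fiber M 1 nx).
rewrite -[leqRHS]sum1_card [leqRHS]big_mkcond /=; apply: leq_sum => c _.
case: ifP => [_|]; last first.
  move=> H; rewrite big1 // => y yU; apply/eqP; rewrite muln_eq0 !eqb0 -negb_and.
  apply/negP=> /andP[/eqP E1 /eqP E2]; move/negP: H; apply; rewrite inE.
  have nc : x - c != 0 by rewrite -expM_mem_roots E1.
  have nc' : x' - c != 0 by rewrite -expM_mem_roots E2.
  rewrite eq_sym -subr_eq0 nc -[c - x']opprB -[c - x]opprB invrN mulrNN expr_div_n E1 E2.
  by rewrite divff ?eqxx // -[X in X != 0]E1 expf_neq0.
rewrite (eq_bigr (fun y => if y == (x - c) ^+ M then ((x' - c) ^+ M == y : nat) else 0%N)).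
  rewrite -big_mkcondr /=; case: (boolP ((x - c) ^+ M \in U)) => xU.
    rewrite (big_pred1 ((x - c) ^+ M)) ?leq_b1 // => y /=.
    by case: eqP => [->|]; rewrite ?andbT ?andbF ?xU.
  by rewrite big1 // => y /andP[yU /eqP yE]; move: xU; rewrite -yE yU.
by move=> y _; rewrite eq_sym; case: eqP => _; rewrite ?mul1n ?mul0n.
Qed.

(** The mean of [q * f X y c] over c is [#|X| * M]. The sum for one class is at most that over all
    classes, which the two moments bound by q n (q - M) (q - n) with n = [#|X|]. *)
Lemma deviation (X : {set K}) (y : K) : y ^+ N = 1 ->
  (\sum_c ((q * f X y c)%:Z - (#|X| * M)%:Z) ^+ 2 <= (q ^ 3 * #|X|)%:Z).
Proof.
move=> y1; pose g z c := ((q * f X z c)%:Z - (#|X| * M)%:Z) ^+ 2.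
have yU : y \in U by rewrite inE y1.
have : \sum_c g y c <= \sum_(z in U) \sum_c g z c.
  rewrite [leRHS](bigD1 y) //= lerDl; apply: sumr_ge0 => z _; apply: sumr_ge0 => c _.
  exact: sqr_ge0.
move/le_trans; apply.
have -> : \sum_(z in U) \sum_c g z c =
  (q ^ 2)%:Z * (\sum_(z in U) \sum_c f X z c ^ 2)%N%:Z
   - (2 * q * #|X| * M)%:Z * (\sum_(z in U) \sum_c f X z c)%N%:Z + (N * q * (#|X| * M) ^ 2)%:Z.
  have -> : (N * q * (#|X| * M) ^ 2)%:Z = \sum_(z in U) \sum_(c : K) ((#|X| * M) ^ 2)%:Z.
    rewrite !sumr_const card_roots_of_unity -mulrnA -mulr_natl natz -PoszM; congr Posz; rewrite /q.
    by rewrite [#|xpredT|](_ : _ = #|K|) // [(N * _)%N]mulnC.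
  rewrite !PoszM; do !rewrite (big_morph Posz PoszD (erefl _)).
  rewrite !big_distrr -!sumrB -big_split /=; apply: eq_bigr => z _.
  do !rewrite (big_morph Posz PoszD (erefl _)).
  rewrite !big_distrr -!sumrB -big_split /=; apply: eq_bigr => c _.
  by rewrite /g !(expnS, expn0, muln1) !PoszM; ring.
have := second_moment X; rewrite first_moment.
move: (\sum_(z in U) _)%N => S2 hS.
have q1 := finNzRing_gt1 K; rewrite -/q in q1.
have Xq : (#|X| <= q)%N by exact: max_card.
have E : q = (M * N).+1 by rewrite MN prednK // ltnW.
move: (#|X|) Xq hS => n Xq hS.
have hS' : (q ^ 2)%:Z * S2%:Z <= (q ^ 2)%:Z * (n * (q - 1) + n * (n - 1) * (M - 1))%N%:Z.
  by rewrite ler_wpM2l // lez_nat.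
apply: (@le_trans _ _ ((q ^ 2)%:Z * (n * (q - 1) + n * (n - 1) * (M - 1))%N%:Z -
   (2 * q * n * M)%:Z * (n * (q - 1))%N%:Z + (N * q * (n * M) ^ 2)%:Z)).
  by rewrite lerD2r lerD2r.
case: n Xq {hS hS'} => [|n] Xq; first by rewrite !(mul0n, muln0, add0n, mulr0) subrr.
have [m Mm] : exists m, M = m.+1 by exists M.-1; rewrite prednK.
have [t qt] : exists t, q = (n.+1 + t)%N by exists (q - n.+1)%N; rewrite subnKC.
have EZ : q%:Z = M%:Z * N%:Z + 1 by rewrite E -PoszM -addn1 PoszD.
have -> : (q ^ 2)%:Z * (n.+1 * (q - 1) + n.+1 * (n.+1 - 1) * (M - 1))%N%:Z -
   (2 * q * n.+1 * M)%:Z * (n.+1 * (q - 1))%N%:Z + (N * q * (n.+1 * M) ^ 2)%:Z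
   = q%:Z * n.+1%:Z * (q%:Z - M%:Z) * (q%:Z - n.+1%:Z).
  have q1Z : (q - 1)%N%:Z = M%:Z * N%:Z by rewrite E subSS subn0 PoszM.
  rewrite !(PoszM, PoszD, expnS, expn0) q1Z !subn1 Mm /= !mulr1 -[in n.+1]addn1 -[in m.+1]addn1.
  rewrite !(PoszM, PoszD); move: EZ; rewrite Mm -addn1 PoszD => ->; ring.
have Mq : M%:Z <= q%:Z.
  rewrite EZ; have : (M * 1 <= M * N)%N by rewrite leq_mul2l N_gt0 orbT.
  lia.
rewrite !(PoszM, expnS, expn0) mulr1.
have h1 : 0 <= q%:Z - M%:Z by rewrite subr_ge0.
have h2 : 0 <= q%:Z - n.+1%:Z by rewrite subr_ge0 lez_nat.
have h3 : (q%:Z - M%:Z) * (q%:Z - n.+1%:Z) <= q%:Z * q%:Z by apply: ler_pM => //; lia.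
have h4 : 0 <= q%:Z * n.+1%:Z by [].
have := ler_wpM2l h4 h3; lia.
Qed.

(* Chebyshev's inequality; on average the counted sets have about #|X| / N elements. *)
Lemma card_bad (X : {set K}) (y : K) (t : nat) : y ^+ N = 1 -> (q <= t * #|X|)%N ->
  (#|[set c | (4 * N * f X y c < #|X|)%N]| <= 16 * t * N ^ 2)%N.
Proof.
move=> y1 qX; set B := [set c | _].
have q1 : (0 < q)%N by exact: ltnW (finNzRing_gt1 K).
have X0 : (0 < #|X|)%N by case: #|X| qX q1 => // ; rewrite muln0 leqn0 => /eqP ->.
have q2 : (q <= 2 * (M * N))%N.
  by rewrite MN mul2n -addnn; have := finNzRing_gt1 K; rewrite -/q; lia.
have h : (#|B| * (#|X| * M) ^ 2)%N%:Z <= 4 * (q ^ 3 * #|X|)%N%:Z.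
  apply: le_trans (ler_wpM2l (isT : 0 <= 4 :> int) (deviation X y1)).
  have -> : (#|B| * (#|X| * M) ^ 2)%N%:Z = \sum_(c in B) ((#|X| * M) ^ 2)%N%:Z.
    by rewrite sumr_const -mulr_natl natz -PoszM.
  rewrite big_distrr [leRHS](bigID (mem B)) /= -[leLHS]addr0; apply: lerD; last first.
    by apply: sumr_ge0 => c _; rewrite mulr_ge0 // sqr_ge0.
  apply: ler_sum => c; rewrite inE => hc.
  (* For a bad c, [q * f X y c] is at most half of its mean, so the squared deviation is at least a
     quarter of the squared mean. *)
  have h2 : (2 * (q * f X y c) <= #|X| * M)%N.
    have : (2 * (q * f X y c) * N <= #|X| * M * N)%N.
      apply: (@leq_trans (2 * (2 * (M * N) * f X y c) * N)); first by rewrite !leq_mul.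
      by have := ltnW hc; nia.
    by rewrite leq_pmul2r // N_gt0.
  rewrite expnS expn1 PoszM -expr2.
  move: (#|X| * M)%N (q * f X y c)%N h2 => u v h2; nia.
have {}h : (#|B| * (#|X| * M ^ 2) <= 4 * q ^ 3)%N.
  by rewrite -(leq_pmul2r X0); move: h; nia.
have {}h : (#|B| * M ^ 2 <= 4 * t * q ^ 2)%N.
  by rewrite -(leq_pmul2r q1); nia.
have : (#|B| * M ^ 2 <= 16 * t * N ^ 2 * M ^ 2)%N.
  apply: (leq_trans h); apply: (@leq_trans (4 * t * (2 * (M * N)) ^ 2)).
    by rewrite leq_mul2l leq_exp2r // q2 orbT.
  by rewrite leq_eqVlt; apply/orP; left; apply/eqP; ring.
by rewrite leq_pmul2r // expn_gt0 M_gt0.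
Qed.

End Moments.

(** Induction on m, for sets of density at least 1/t. By [card_bad], some x_0 in [X 0] leaves each
    later set with density at least 1/(4 N t) inside its prescribed class around x_0; the other x_j
    are then found in these smaller sets. *)
Lemma prescribed_differences_in (N m t : nat) : exists Q, forall (K : finFieldType) (M : nat),
  (M * N)%N = #|K|.-1 -> (Q <= #|K|)%N ->
  forall (X : nat -> {set K}) (kappa : nat -> nat -> K),
  (forall i, (i < m)%N -> (#|K| <= t * #|X i|)%N) ->
  (forall i j, kappa i j ^+ N = 1) ->
  exists x : nat -> K, (forall i, (i < m)%N -> x i \in X i) /\
    (forall i j, (i < j < m)%N -> (x j - x i) ^+ M = kappa i j).
Proof.
elim: m t => [|m IH] t.
  by exists 0%N => K M _ _ X kappa _ _; exists (fun _ => 0); split=> // i j; rewrite andbF.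
have [Q HQ] := IH (t * (4 * N))%N.
(* The second term makes [X 0] larger than the union of the m exceptional sets, each of at most 16 t
   N^2 elements. *)
exists (maxn Q (t * (m * (16 * t * N ^ 2))).+1) => K M MN.
rewrite geq_max => /andP[qQ qt] X kappa hX hk.
pose f j c := #|[set x in X j.+1 | (x - c) ^+ M == kappa 0%N j.+1]|.
pose Bad (j : 'I_m) := [set c | (4 * N * f j c < #|X j.+1|)%N].
have hB : (#|\bigcup_(j < m) Bad j| < #|X 0%N|)%N.
  have h1 : (#|\bigcup_(j < m) Bad j| <= m * (16 * t * N ^ 2))%N.
    rewrite -[m in leqRHS]card_ord -sum_nat_const.
    elim/big_ind2: _ => [|A a B b hA hB|j _]; first by rewrite cards0.
      by apply: leq_trans (leq_add hA hB); rewrite cardsU leq_subr.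
    by apply: (card_bad MN) => //; apply: hX; rewrite ltnS.
  apply: (leq_ltn_trans h1); have := leq_trans qt (hX 0%N isT).
  by case: t {IH HQ hX qt h1} => [|t] //; rewrite ltn_pmul2l.
have /subsetPn[x0 x0X x0B] : ~~ (X 0%N \subset \bigcup_(j < m) Bad j).
  by apply: contraTN hB => /subset_leq_card; rewrite -leqNgt.
have [||x [xX xk]] := HQ K M MN qQ (fun j => [set x in X j.+1 | (x - x0) ^+ M == kappa 0%N j.+1])
    (fun i j => kappa i.+1 j.+1).
- move=> j jm; apply: leq_trans (hX j.+1 jm) _; rewrite -mulnA leq_mul2l.
  apply/orP; right; rewrite leqNgt; apply: contra x0B => hj.
  by apply/bigcupP; exists (Ordinal jm) => //; rewrite inE.
- by move=> i j; apply: hk.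
exists (fun i => if i is i'.+1 then x i' else x0); split=> [[|i] //|[|i] [|j] //].
- by rewrite ltnS => /xX; rewrite inE => /andP[].
- by rewrite /= ltnS => /xX; rewrite inE => /andP[_ /eqP].
- by rewrite !ltnS => /xk.
Qed.

Lemma prescribed_differences (N m : nat) : exists Q, forall (K : finFieldType) (M : nat),
  (M * N)%N = #|K|.-1 -> (Q <= #|K|)%N ->
  forall kappa : nat -> nat -> K, (forall i j, kappa i j ^+ N = 1) ->
  exists x : nat -> K, forall i j, (i < j < m)%N -> (x j - x i) ^+ M = kappa i j.
Proof.
have [Q HQ] := prescribed_differences_in N m 1.
exists Q => K M MN qQ kappa hk.
have [|x [_ hx]] := HQ K M MN qQ (fun _ => setT) kappa _ hk; last by exists x.
by move=> i _; rewrite cardsT mul1n.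
Qed.

Lemma card_bigcup_le (I T : finType) (A : I -> {set T}) (M : nat) :
  (forall i, #|A i| <= M)%N -> (#|\bigcup_i A i| <= #|I| * M)%N.
Proof.
move=> hA; rewrite -sum_nat_const.
elim/big_ind2: _ => [|B a C b hB hC|i _] //; first by rewrite cards0.
by apply: leq_trans (leq_add hB hC); rewrite cardsU leq_subr.
Qed.

(** * Greedy choice of the symmetric blocks *)

Section Greedy.
Variables (K : finFieldType) (M n s : nat).
Hypothesis MN : (M * (n * s))%N = #|K|.-1.
Hypothesis two_nz : 2%:R != 0 :> K.
Let Sh := option ('I_n * bool).
(** In the application [cst p u] is tau of the difference of the second coordinates, or 1 if they
    agree, and [omega] enumerates the n-th roots of unity. *)
Variables (cst : 'I_n -> Sh -> K) (omega : 'I_n -> K).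
Hypothesis cst_nz : forall p u, cst p u != 0.
Hypothesis omega1 : forall p, omega p ^+ n = 1.
Hypothesis s_big : ((2 * n + 1) + (2 * n + 1) * n * (2 * n + 1) * 2 + (2 * n + 1) * (2 * n + 1) * 2 < s)%N.

(* [Some (p, e)] stands for the point (-1)^e a_p of a symmetric block, [None] for its centre 0. *)
Definition shift (a : 'I_n -> K) (u : Sh) : K :=
  if u is Some (p, e) then (-1) ^+ e * a p else 0.
(** The points already placed when a_p is chosen. *)
Definition below (p : nat) (u : Sh) : bool :=
  if u is Some (p', _) then (p' < p)%N else true.
Definition colour (a : 'I_n -> K) (p : 'I_n) (u : Sh) : K :=
  (a p - shift a u) ^+ M / cst p u.

(** Colours must differ even up to sign, since exchanging the two points of a pair negates its
    colour. The value [omega p] serves the pair {a_p, -a_p}, whose points share their second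
    coordinate. *)
Definition spread (m : nat) (a : 'I_n -> K) :=
  [/\ forall p : 'I_n, (p < m)%N -> a p ^+ (M * s) = omega p,
      forall (p : 'I_n) u, (p < m)%N -> below p u -> a p != shift a u
    & forall (p q : 'I_n) u v (e : bool), (p < m)%N -> (q < m)%N -> below p u -> below q v ->
        colour a p u = (-1) ^+ e * colour a q v -> (p, u) = (q, v)].

(** With the signs collected on one side, the condition on the larger of two indices separates the
    points; a_q and -a_q differ since 2 a_q != 0. *)
Lemma shift_inj (m : nat) a u v : spread m a -> below m u -> below m v -> u != v ->
  shift a u != shift a v.
Proof.
move=> [_ nz _].
have nz0 (q : 'I_n) : (q < m)%N -> a q != 0 by move=> qp; apply: (nz q None).
have sym (x y : K) (e e' : bool) : x != (-1) ^+ (e (+) e') * y -> (-1) ^+ e * x != (-1) ^+ e' * y.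
  apply: contraNN => /eqP h; rewrite signr_addb -mulrA -h.
  by rewrite mulrA -signr_addb addbb mul1r.
case: u => [[q e]|]; case: v => [[q' e']|] //= hu hv huv.
- have [lt|lt|/val_inj E] := ltngtP q q'.
  + rewrite eq_sym; apply: sym.
    have := nz q' (Some (q, e' (+) e)) hv lt; by [].
  + by apply: sym; exact: (nz q (Some (q', e (+) e')) hu lt).
  + move: huv; rewrite E; case: e; case: e'; rewrite ?eqxx // => _;
    rewrite /= !expr0 !expr1 mul1r mulN1r -subr_eq0 -?opprD ?opprK ?oppr_eq0 ?opprB -mulr2n -mulr_natl;
    by rewrite mulf_neq0 // nz0.
- by rewrite mulf_neq0 ?signr_eq0 // nz0.
- by rewrite eq_sym mulf_neq0 ?signr_eq0 // nz0.
Qed.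

Let M_gt0 : (0 < M)%N := (card_pred_factors_gt0 MN).1.

Lemma spreadS (m : 'I_n) a : spread m a -> exists x, spread m.+1 (fun p => if p == m then x else a p).
Proof.
move=> ha; have [a1 a2 a3] := ha.
(* [Bad1] keeps x away from the other points, [Bad2] keeps a new colour from equalling an old one up
   to sign, and [Bad3] does so for two new colours. The numbers of such sets are the three summands
   in [s_big], and each set has at most M elements. *)
pose Bad1 (u : Sh) := [set shift a u].
pose Bad2 (i : Sh * 'I_n * Sh * bool) := let: (u, q, v, e) := i in
  [set x | (x - shift a u) ^+ M == cst m u * ((-1) ^+ e * colour a q v)].
pose Bad3 (i : Sh * Sh * bool) := let: (u, v, e) := i in
  [set x | [&& below m u, below m v, u != v, x != shift a v &
     ((x - shift a u) / (x - shift a v)) ^+ M == (-1) ^+ e * cst m u / cst m v]].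
pose Bad := \bigcup_u Bad1 u :|: \bigcup_i Bad2 i :|: \bigcup_i Bad3 i.
have cSh : #|{: Sh}| = (2 * n + 1)%N by rewrite card_option card_prod card_ord card_bool mulnC addn1.
have b1 : (#|\bigcup_u Bad1 u| <= (2 * n + 1) * M)%N.
  by rewrite -cSh; apply: card_bigcup_le => u; rewrite cards1.
have b2 : (#|\bigcup_i Bad2 i| <= (2 * n + 1) * n * (2 * n + 1) * 2 * M)%N.
  have -> : ((2 * n + 1) * n * (2 * n + 1) * 2 = #|{: Sh * 'I_n * Sh * bool}|)%N.
    by rewrite !card_prod cSh card_ord card_bool.
  apply: card_bigcup_le => -[[[u q] v] e] /=.
  rewrite -(card_imset _ (addIr (- shift a u))).
  apply: leq_trans (card_root_set (cst m u * ((-1) ^+ e * colour a q v)) M_gt0).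
  by apply/subset_leq_card/subsetP=> y /imsetP[x]; rewrite !inE => ? ->.
have b3 : (#|\bigcup_i Bad3 i| <= (2 * n + 1) * (2 * n + 1) * 2 * M)%N.
  have -> : ((2 * n + 1) * (2 * n + 1) * 2 = #|{: Sh * Sh * bool}|)%N.
    by rewrite !card_prod cSh card_bool.
  apply: card_bigcup_le => -[[u v] e] /=.
  case: (boolP [&& below m u, below m v & u != v]) => [/and3P[hu hv huv]|h]; last first.
    rewrite (_ : [set _ | _] = set0) ?cards0 //; apply/setP=> x; rewrite !inE.
    by apply: contraNF h => /and5P[-> -> ->].
  apply: leq_trans (card_root_set ((-1) ^+ e * cst m u / cst m v) M_gt0).
  apply: leq_trans (subset_leq_card _) (leq_trans (card_mobius_fiber M _ (shift_inj ha hu hv huv)) _).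
  - by apply/subsetP=> x; rewrite !inE => /and5P[_ _ _ -> h]; exact: h.
  - by apply/subset_leq_card/subsetP=> z; rewrite !inE => /andP[_].
have hBad : (#|Bad| < #|[set x : K | x ^+ (M * s) == omega m]|)%N.
  rewrite (card_fiber (N := n)) ?omega1 //; last by rewrite -MN [(n * s)%N]mulnC mulnA.
  apply: (@leq_ltn_trans (((2 * n + 1) + (2 * n + 1) * n * (2 * n + 1) * 2 +
     (2 * n + 1) * (2 * n + 1) * 2) * M)%N); last by rewrite mulnC ltn_pmul2l.
  rewrite /Bad cardsU; apply: leq_trans (leq_subr _ _) _; rewrite mulnDl; apply: leq_add b3.
  by rewrite cardsU; apply: leq_trans (leq_subr _ _) _; rewrite mulnDl; apply: leq_add b1 b2.
have /subsetPn[x] : ~~ ([set x : K | x ^+ (M * s) == omega m] \subset Bad).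
  by apply: contraTN hBad => /subset_leq_card; rewrite -leqNgt.
rewrite inE => /eqP xw; rewrite !inE !negb_or => /andP[/andP[nb1 nb2] nb3].
exists x; set a' := fun p => _.
have a'm : a' m = x by rewrite /a' eqxx.
have a'E (p : 'I_n) : (p < m)%N -> a' p = a p by rewrite /a'; case: eqP => // ->; rewrite ltnn.
have sE (p : 'I_n) u : (p <= m)%N -> below p u -> shift a' u = shift a u.
  by case: u => [[q e]|] //= pm qp; rewrite a'E // (leq_trans qp pm).
have cE (p : 'I_n) u : (p < m)%N -> below p u -> colour a' p u = colour a p u.
  by move=> pm hu; rewrite /colour a'E // (sE p) // ltnW.
have xsh u : x != shift a u.
  by apply: contraNneq nb1 => ->; apply/bigcupP; exists u; rewrite // inE.
have newold (q : 'I_n) u v (e : bool) : (q < m)%N -> below m u -> below q v ->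
    colour a' m u <> (-1) ^+ e * colour a' q v.
  move=> qm hu hv; rewrite (cE q) // /colour a'm (sE m) // => h.
  move/negP: nb2; apply; apply/bigcupP; exists (u, q, v, e) => //.
  by rewrite inE -h mulrC divfK.
have lem (p : 'I_n) : (p < m.+1)%N -> p = m \/ (p < m)%N.
  by rewrite ltnS leq_eqVlt => /orP[/eqP/val_inj|]; [left|right].
split.
- by move=> p /lem[->|pm]; [rewrite a'm|rewrite a'E // a1].
- move=> p u /lem[->|pm] hu; first by rewrite a'm (sE m).
  by rewrite a'E // (sE p) ?(ltnW pm) // a2.
- move=> p q u v e /lem[->|pm] /lem[->|qm] hu hv.
  + rewrite /colour a'm !(sE m) // => h; congr pair; apply/eqP/negPn/negP=> uv.
    move/negP: nb3; apply; apply/bigcupP; exists (u, v, e) => //.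
    rewrite inE hu hv uv xsh /= expr_div_n.
    have nz w : (x - shift a w) ^+ M != 0 by rewrite expf_neq0 // subr_eq0 xsh.
    rewrite eqr_div ?nz // -[X in X * _](divfK (cst_nz m u)) h; apply/eqP.
    by field; rewrite cst_nz.
  + by move/newold=> h; case: h.
  + move=> h; case: (@newold p v u e) => //; rewrite h mulrA -signr_addb addbb mul1r //.
  + by rewrite !cE //; apply: a3.
Qed.

Lemma spread_exists : exists a, spread n a.
Proof.
suff H m : (m <= n)%N -> exists a, spread m a by apply: H.
elim: m => [|m IH] mn; first by exists (fun _ => 0); split.
have [a ha] := IH (ltnW mn).
by have [x hx] := @spreadS (Ordinal mn) a ha; eexists; exact: hx.
Qed.

End Greedy.

(** * Difference families and group actions *)

(* Makes a product of two finZmodTypes a finZmodType. *)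
HB.saturate prod.

Definition translate (A : finZmodType) (W : {set A}) (c : A) : {set A} := [set x + c | x in W].

(** Uniqueness up to translation is what makes all translates of blocks through two given points
    coincide. *)
Definition difference_family (A : finZmodType) (k : nat) (Fam : {set {set A}}) :=
  [/\ forall W, W \in Fam -> #|W| = k,
      forall z : A, z != 0 -> exists W u, [/\ W \in Fam, u \in W & u + z \in W]
    & forall (z : A) W W' u u', z != 0 -> W \in Fam -> W' \in Fam ->
        u \in W -> u + z \in W -> u' \in W' -> u' + z \in W' -> W' = translate W (u' - u)].

Section DifferenceFamily.
Variables (A : finZmodType) (k : nat).
Variable Fam : {set {set A}}.
Definition development : {set {set A}} := [set translate W c | W in Fam, c in [set: A]].

Hypothesis Fam_df : difference_family k Fam.

Lemma translateD (W : {set A}) c c' : translate (translate W c) c' = translate W (c + c').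
Proof.
rewrite /translate -imset_comp; apply: eq_imset => x /=; by rewrite addrA.
Qed.

Lemma mem_translate (W : {set A}) c x : (x \in translate W c) = (x - c \in W).
Proof.
apply/imsetP/idP => [[y yW ->]|h]; first by rewrite addrK.
by exists (x - c); rewrite ?subrK.
Qed.

Lemma translate0 (W : {set A}) : translate W 0 = W.
Proof. by apply/setP=> x; rewrite mem_translate subr0. Qed.

(** Translates of blocks through x and y correspond to representations of y - x as a difference
    inside a block of [Fam]. *)
Lemma development_design : is_design #|{: A}| k development.
Proof.
have [card_Fam cover_Fam uniq_Fam] := Fam_df; split=> // [B /imset2P[W c WF _ ->]|x y xy].
  by rewrite card_imset ?card_Fam //; apply: addIr.
have z0 : y - x != 0 by rewrite subr_eq0 eq_sym.
have [W [u [WF uW vW]]] := cover_Fam _ z0.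
exists (translate W (x - u)); split.
  split; first by apply: imset2_f; rewrite ?inE.
    by rewrite mem_translate opprB addrC subrK.
  by rewrite mem_translate opprB addrCA.
move=> B' [/imset2P[W' c' WF' _ ->]]; rewrite !mem_translate => xW yW.
have E : x - c' + (y - x) = y - c' by rewrite addrC addrA subrK.
rewrite (uniq_Fam _ _ _ _ _ z0 WF WF' uW vW xW) ?E // translateD; congr translate.
by rewrite addrAC subrK.
Qed.

Lemma development_aut (s : {perm A}) :
  {morph s : x y / x + y} -> (forall W, W \in Fam -> s @: W \in Fam) -> s \in design_aut development.
Proof.
move=> sD sF; rewrite inE eqEcard card_imset ?leqnn ?andbT; last exact: imset_inj (@perm_inj _ s).
apply/subsetP=> _ /imsetP[_ /imset2P[W c WF _ ->] ->].
have -> : s @: translate W c = translate (s @: W) (s c).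
  by rewrite /translate -!imset_comp; apply: eq_imset => x /=; rewrite sD.
by apply: imset2_f; rewrite ?inE ?sF.
Qed.

End DifferenceFamily.

Lemma isog_morphim_perm (gT : finGroupType) (T : finType) (G : {group gT}) (D : {set {perm T}})
    (f : gT -> {perm T}) :
  {morph f : x y / (x * y)%g} -> injective f -> (forall g, f g \in D) ->
  exists2 H : {group {perm T}}, H \subset D & G \isog H.
Proof.
move=> fM fI fD.
pose f' := Morphism (in2W fM : {in [set: gT] &, _}).
exists (f' @* G)%G.
  by apply/subsetP=> _ /morphimP[g _ _ ->].
apply: (sub_isog (f := f')); first exact: subsetT.
by apply/injmP=> x y _ _; apply: fI.
Qed.

(** * The regular action on coordinates and an invariant homogeneous function *)

Section Regular.
Variables (gT : finGroupType) (K : finFieldType).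
Local Notation n := #|{: gT}|.
Local Notation V := 'rV[K]_n.

(** The group elements index the coordinates. Multiplying indices by g on the left gives a right
    action, in accordance with the product of permutations. *)
Definition transl (g : gT) (v : V) : V := \row_i v 0 (enum_rank (g * enum_val i)%g).

Lemma translM g h v : transl (g * h)%g v = transl h (transl g v).
Proof. by apply/rowP=> i; rewrite !mxE enum_rankK mulgA. Qed.

Lemma transl1 v : transl 1%g v = v.
Proof. by apply/rowP=> i; rewrite !mxE mul1g enum_valK. Qed.

Lemma translD g : {morph transl g : u v / u + v}.
Proof. by move=> u v; apply/rowP=> i; rewrite !mxE. Qed.

Lemma translZ g c v : transl g (c *: v) = c *: transl g v.
Proof. by apply/rowP=> i; rewrite !mxE. Qed.

Lemma translK g : cancel (transl g) (transl g^-1%g).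
Proof. by move=> v; rewrite -translM mulgV transl1. Qed.

Lemma transl_eq0 g (v : V) : (transl g v == 0) = (v == 0).
Proof.
have t0 h : transl h 0 = 0 by apply/rowP=> i; rewrite !mxE.
by apply/eqP/eqP=> [h|->]; rewrite ?t0 // -(translK g v) h t0.
Qed.

Lemma transl_faithful g h : transl g =1 transl h -> g = h.
Proof.
move=> E; have /rowP/(_ (enum_rank 1%g)) := E (\row_i (i == enum_rank h)%:R).
rewrite !mxE !enum_rankK !mulg1 eqxx; case: eqP => [/enum_rank_inj //|_] /eqP.
by rewrite eq_sym oner_eq0.
Qed.

(* The stabiliser in gT of a line acts on it by scalars whose order divides #|gT|. *)
Lemma exists_homogeneous_invariant (M N : nat) :
  (M * N)%N = #|K|.-1 -> (n %| M)%N ->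
  exists col : V -> K, [/\ forall (c : K) (v : V), c != 0 -> v != 0 -> col (c *: v) = c ^+ M * col v,
    forall g (v : V), v != 0 -> col (transl g v) = col v & forall v : V, v != 0 -> col v ^+ N = 1].
Proof.
move=> MN nM.
(* [o v] is the orbit of v under nonzero scalars and the group. If v = c *: transl g r with r the
   representative of the orbit, the value at v will be c^M. *)
pose o (v : V) := [set w : V | [exists c : K, exists g, (c != 0) && (w == c *: transl g v)]].
have oP v w : reflect (exists c g, c != 0 /\ w = c *: transl g v) (w \in o v).
  rewrite inE; apply: (iffP existsP) => [[c /existsP[g /andP[c0 /eqP]]]|[c [g [c0 ->]]]].
    by exists c, g.
  by exists c; apply/existsP; exists g; rewrite c0 eqxx.
have o_sym v w : w \in o v -> v \in o w.
  move/oP=> [c [g [c0 ->]]]; apply/oP; exists c^-1, g^-1%g; split; first by rewrite invr_eq0.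
  by rewrite translZ translK scalerA mulVf // scale1r.
have o_sub v w : w \in o v -> o w \subset o v.
  move/oP=> [c [g [c0 ->]]]; apply/subsetP=> x /oP[d [h [d0 ->]]]; apply/oP.
  by exists (d * c), (g * h)%g; rewrite mulf_neq0 // translZ -translM scalerA.
have o_eq v w : w \in o v -> o w = o v.
  by move=> h; apply/eqP; rewrite eqEsubset !o_sub // o_sym.
(* [pick] sees only the set [o v], so a whole orbit gets one representative; the default 0 does not
   arise because v lies in [o v]. *)
pose rep (v : V) : V := odflt (0 : V) [pick w in o v].
have rep_o (v : V) : rep v \in o v.
  rewrite /rep; case: pickP => // /(_ v) /negP[]; apply/oP; exists 1, 1%g.
  by rewrite oner_neq0 scale1r transl1.
have rep_eq (v w : V) : w \in o v -> rep w = rep v by move=> h; rewrite /rep (o_eq _ _ h).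
pose coef (v : V) : K := odflt (0 : K) [pick c : K | (c != 0) && [exists g, v == c *: transl g (rep v)]].
have coefP (v : V) : coef v != 0 /\ exists g, v = coef v *: transl g (rep v).
  rewrite /coef; case: pickP => [c /andP[c0 /existsP[g /eqP E]]|h]; first by split => //; exists g.
  have /oP[c [g [c0 E]]] := o_sym _ _ (rep_o v).
  have := h c; rewrite c0 => /negbT/negP[]; apply/existsP; exists g; exact/eqP.
have wd (c d : K) g h (w : V) : w != 0 -> c != 0 -> d != 0 ->
    c *: transl g w = d *: transl h w -> c ^+ M = d ^+ M.
  move=> w0 c0 d0 E.
  (* A group element acts on the line of w as the scalar c / d. Its n-th power, for n the group
     order, is trivial, hence (d / c)^n = 1, and n divides M. *)
  have E1 : w = (d / c) *: transl (h * g^-1)%g w.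
    by rewrite translM mulrC -scalerA -translZ -E translZ translK scalerA mulVf // scale1r.
  have E2 m : w = (d / c) ^+ m *: transl ((h * g^-1) ^+ m)%g w.
    elim: m => [|m IH]; first by rewrite expr0 expg0 scale1r transl1.
    by rewrite exprS expgSr translM -scalerA -translZ -IH.
  have e1 : ((h * g^-1) ^+ n = 1)%g by rewrite -cardsT expg_cardG ?inE.
  have := E2 n; rewrite e1 transl1 => /eqP.
  rewrite -subr_eq0 -{1}[w]scale1r -scalerBl scaler_eq0 (negPf w0) orbF subr_eq0 => /eqP dc.
  have [t Mt] := dvdnP nM.
  have : (d / c) ^+ M = 1 by rewrite Mt mulnC exprM -dc expr1n.
  by rewrite expr_div_n => /divr1_eq.
have rep_nz (v : V) : v != 0 -> rep v != 0.
  apply: contraNneq => r0; have [_ [g ->]] := coefP v.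
  by rewrite r0 scaler_eq0 transl_eq0 eqxx orbT.
clearbody coef; clearbody rep; clearbody o.
exists (fun v => coef v ^+ M); split.
- move=> c v c0 v0; have [cv [g Eg]] := coefP v; have [ccv [h Eh]] := coefP (c *: v).
  have E : rep (c *: v) = rep v.
    by apply: rep_eq; apply/oP; exists c, 1%g; rewrite transl1.
  rewrite -exprMn; apply: (wd _ _ h g (rep v)).
  + exact: rep_nz.
  + exact: ccv.
  + by rewrite mulf_neq0.
  + by rewrite -[X in _ *: transl _ X]E -Eh {1}Eg scalerA.
- move=> g v v0; have [cv [g1 Eg]] := coefP v; have [cgv [h Eh]] := coefP (transl g v).
  have E : rep (transl g v) = rep v.
    by apply: rep_eq; apply/oP; exists 1, g; rewrite oner_neq0 scale1r.
  apply: (wd _ _ h (g1 * g)%g (rep v)).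
  + exact: rep_nz.
  + exact: cgv.
  + exact: cv.
  + by rewrite -[X in _ *: transl _ X]E -Eh {1}Eg translZ translM.
- move=> v v0; have [cv _] := coefP v; by rewrite -exprM MN expf_card_pred.
Qed.

End Regular.

(** * The family generated by coloured base blocks *)

Section Family.
Variables (K F : finFieldType) (m M n s k : nat).
Local Notation V := 'rV[K]_m.
Hypothesis MN : (M * (n * s))%N = #|K|.-1.
Hypothesis M_even : ~~ odd M.
Variables (col : V -> K) (tau : F -> K).
Hypothesis colZ : forall (c : K) (v : V), c != 0 -> v != 0 -> col (c *: v) = c ^+ M * col v.
Hypothesis col_root : forall v : V, v != 0 -> col v ^+ (n * s) = 1.
Hypothesis tauM : {morph tau : x y / x * y}.
Hypothesis tau_inj : {in predC1 0 &, injective tau}.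
Hypothesis tau_root : forall y, y != 0 -> tau y ^+ s = 1.
Hypothesis tau_surj : forall x : K, x ^+ s = 1 -> exists2 y, y != 0 & tau y = x.

Variables (Base Pos : finType) (sym : pred Base) (flip : Pos -> Pos).
Variables (X : Base -> Pos -> K) (Y : Base -> Pos -> F) (Vert : {set {set F}}).
Hypothesis card_Pos : #|Pos| = k.
Hypothesis X_inj : forall b, injective (X b).
Hypothesis X_flip : forall b i, sym b -> X b (flip i) = - X b i.
Hypothesis Y_flip : forall b i, sym b -> Y b (flip i) = Y b i.
Hypothesis Y_eq : forall b i j, i != j -> Y b i = Y b j -> sym b /\ j = flip i.
(** A difference ((x_j - x_i) d, l (y_j - y_i)) in a block with col d = tau l has this as the
    quotient of col of its first coordinate by tau of its second, independently of d and l. *)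
Definition base_colour b i j := (X b j - X b i) ^+ M / tau (Y b j - Y b i).
Hypothesis colour_inj : forall b i j b' i' j', Y b i != Y b j -> Y b' i' != Y b' j' ->
  base_colour b i j = base_colour b' i' j' ->
  b = b' /\ ((i', j') = (i, j) \/ sym b /\ (i', j') = (flip i, flip j)).
Hypothesis colour_surj : forall x : K, x ^+ (n * s) = 1 ->
  exists b i j, Y b i != Y b j /\ base_colour b i j = x.
(** If y_j = y_i, the second coordinate of the difference is 0 and col of the first is known up to
    the factor tau l. The power s removes this factor and leaves an n-th root of unity. *)
Hypothesis loop_inj : forall b i b' i', sym b -> sym b' -> i != flip i -> i' != flip i' ->
  (X b (flip i) - X b i) ^+ (M * s) = (X b' (flip i') - X b' i') ^+ (M * s) ->
  b = b' /\ (i' = i \/ i' = flip i).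
Hypothesis loop_surj : forall x : K, x ^+ n = 1 ->
  exists b i, [/\ sym b, i != flip i & (X b (flip i) - X b i) ^+ (M * s) = x].
Hypothesis Vert_df : difference_family k Vert.

Definition base_block b (d : V) (l : F) : {set V * F} := [set (X b i *: d, l * Y b i) | i : Pos].
Definition vertical (C : {set F}) : {set V * F} := [set ((0 : V), y) | y in C].
Definition family : {set {set V * F}} :=
  [set W | [exists b, exists d : V, exists l, [&& d != 0, l != 0, col d == tau l & W == base_block b d l]]]
  :|: [set vertical C | C in Vert].

Let tau_neq0 y : y != 0 -> tau y != 0.
Proof.
have [_ /[!muln_gt0]/andP[_ s0]] := card_pred_factors_gt0 MN.
by move/tau_root; apply: root_of_unity_neq0.
Qed.

Lemma familyP W : W \in family ->
  (exists b d l, [/\ d != 0, l != 0, col d = tau l & W = base_block b d l]) \/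
  (exists2 C, C \in Vert & W = vertical C).
Proof.
case/setUP; last by case/imsetP=> C CV ->; right; exists C.
rewrite inE => /existsP[b /existsP[d /existsP[l /and4P[d0 l0 /eqP cl /eqP ->]]]].
by left; exists b, d, l.
Qed.

Lemma base_block_family b d l : d != 0 -> l != 0 -> col d = tau l -> base_block b d l \in family.
Proof.
move=> d0 l0 cl; apply/setUP; left; rewrite inE; apply/existsP; exists b.
by apply/existsP; exists d; apply/existsP; exists l; rewrite d0 l0 cl !eqxx.
Qed.

Lemma vertical_family C : C \in Vert -> vertical C \in family.
Proof. by move=> CV; apply/setUP; right; apply: imset_f. Qed.

Lemma card_family W : W \in family -> #|W| = k.
Proof.
have [card_Vert _ _] := Vert_df.
case/familyP=> [[b [d [l [d0 l0 _ ->]]]]|[C CV ->]].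
  rewrite card_imset // => i j [/eqP]; rewrite -subr_eq0 -scalerBl scaler_eq0 (negPf d0) orbF.
  by rewrite subr_eq0 => /eqP/X_inj.
by rewrite card_imset ?card_Vert // => x y [].
Qed.

(** Differences with v = 0 come from [Vert]. Otherwise d = v / (x_j - x_i), where the pair (i, j) is
    dictated by col v / tau dl if dl != 0, and by [col v ^+ s] if dl = 0. *)
Lemma cover_family (z : V * F) : z != 0 ->
  exists W u, [/\ W \in family, u \in W & u + z \in W].
Proof.
have [_ cover_Vert _] := Vert_df.
case: z => v dl z0; have [v0|v0] := eqVneq v 0.
  have dl0 : dl != 0 by apply: contraNneq z0 => ->; rewrite v0.
  have [C [u [CV uC vC]]] := cover_Vert _ dl0.
  exists (vertical C), (0, u); split; first exact: vertical_family.
    by apply/imsetP; exists u.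
  by apply/imsetP; exists (u + dl); rewrite // v0; congr pair; rewrite addr0.
have step b i j l : X b j - X b i != 0 -> l != 0 -> l * (Y b j - Y b i) = dl ->
    col ((X b j - X b i)^-1 *: v) = tau l ->
    exists W u, [/\ W \in family, u \in W & u + (v, dl) \in W].
  move=> X0 l0 El cl; set d := _^-1 *: v in cl.
  have d0 : d != 0 by rewrite scaler_eq0 invr_eq0 (negPf X0).
  exists (base_block b d l), (X b i *: d, l * Y b i); split; first exact: base_block_family.
    by apply/imsetP; exists i.
  apply/imsetP; exists j => //; rewrite -El; congr pair => /=.
    rewrite -[v in LHS](_ : (X b j - X b i) *: d = v); last by rewrite scalerA divff ?scale1r.
    by rewrite scalerBl addrC subrK.
  by rewrite mulrBr addrC subrK.
have X0 b i j : i != j -> X b j - X b i != 0.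
  by move=> ij; rewrite subr_eq0; apply: contraNneq ij => /X_inj ->.
have [dl0|dl0] := eqVneq dl 0.
  have [|b [i [sb fi E]]] := @loop_surj (col v ^+ s); first by rewrite -exprM mulnC col_root.
  have Xn := X0 b i (flip i) fi.
  (* Here the second coordinate does not determine l; by the choice of i the required value of tau l
     is an s-th root of unity. *)
  have [|l l0 El] := @tau_surj (col ((X b (flip i) - X b i)^-1 *: v)).
    rewrite colZ ?invr_eq0 // exprMn -E !exprVn -exprM mulVf ?expf_neq0 //.
  apply: (step b i (flip i) l) => //; by rewrite Y_flip // subrr mulr0.
have [|b [i [j [Yij E]]]] := @colour_surj (col v / tau dl).
  by rewrite expr_div_n col_root // mulnC exprM tau_root // expr1n divr1.
have ij : i != j by apply: contraNneq Yij => ->.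
have Y0 : Y b j - Y b i != 0 by rewrite subr_eq0 eq_sym.
apply: (step b i j (dl / (Y b j - Y b i))); first exact: X0.
- by rewrite mulf_neq0 ?invr_eq0.
- by rewrite divfK.
have tY := tau_neq0 Y0; have tdl := tau_neq0 dl0.
have Et : tau (dl / (Y b j - Y b i)) = tau dl / tau (Y b j - Y b i).
  by rewrite -[dl in RHS](divfK Y0) [tau (_ / _ * _)]tauM mulfK.
rewrite colZ ?invr_eq0 ?X0 // Et exprVn.
have Xn : (X b j - X b i) ^+ M != 0 by rewrite expf_neq0 // X0.
have Ec : col v = base_colour b i j * tau dl by rewrite E divfK.
by rewrite Ec /base_colour -!mulrA mulKf // mulrC.
Qed.

(** Reindexing by [flip] negates the first coordinates and preserves the second. *)
Lemma block_flip b d l : sym b -> base_block b (- d) l = base_block b d l.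
Proof.
move=> sb; have sub d' : base_block b (- d') l \subset base_block b d' l.
  apply/subsetP=> _ /imsetP[i _ ->]; apply/imsetP; exists (flip i) => //.
  by rewrite X_flip // Y_flip // scalerN scaleNr.
by apply/eqP; rewrite eqEsubset sub -{1}[d]opprK sub.
Qed.

Lemma block_difference b d l (u z : V * F) : u \in base_block b d l -> u + z \in base_block b d l ->
  exists i j, u = (X b i *: d, l * Y b i) /\ z = ((X b j - X b i) *: d, l * (Y b j - Y b i)).
Proof.
move=> /imsetP[i _ ->] /imsetP[j _ E]; exists i, j; split=> //.
have -> : z = (X b j *: d, l * Y b j) - (X b i *: d, l * Y b i) by rewrite -E addrC addKr.
by rewrite scalerBl mulrBr.
Qed.

(** Equal differences have equal colours, so the hypotheses on colours identify the base block and
    the pair of positions up to a flip. Then d' is d or -d and l' = l, which gives the same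
    block. *)
Lemma uniq_family (z : V * F) W W' u u' : z != 0 -> W \in family -> W' \in family ->
  u \in W -> u + z \in W -> u' \in W' -> u' + z \in W' -> W' = translate W (u' - u).
Proof.
have [_ _ uniq_Vert] := Vert_df.
(* A nonzero difference has first coordinate 0 in a vertical block, but not in a base block, as
   [X b] is injective. *)
have mixed b d l C (x x' y : V * F) : y != 0 -> d != 0 -> x \in base_block b d l ->
    x + y \in base_block b d l -> x' \in vertical C -> x' + y \in vertical C -> False.
  move=> y0 d0 xW xyW /imsetP[c _ ->] /imsetP[c' _ E].
  have [i [j [_ Ey]]] := block_difference xW xyW.
  have : y.1 = 0 by have := congr1 fst E; rewrite /= add0r.
  rewrite Ey /= => /eqP; rewrite scaler_eq0 (negPf d0) orbF subr_eq0 => /eqP/X_inj ij.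
  by move: y0; rewrite Ey ij !subrr scale0r mulr0 eqxx.
move=> z0 /familyP[[b [d [l [d0 l0 cl ->]]]]|[C CV ->]]
  /familyP[[b' [d' [l' [d'0 l'0 cl' ->]]]]|[C' CV' ->]] uW vW uW' vW'; last 3 first.
- by case: (mixed b d l C' u u' z).
- by case: (mixed b' d' l' C u' u z).
- move: uW vW uW' vW' => /imsetP[c cC ->] /imsetP[e eC E] /imsetP[c' cC' ->] /imsetP[e' eC' E'].
  have [Ez Ee] : z = (0, e - c) /\ e' = c' + (e - c).
    have -> : z = ((0 : V), e) - (0, c) by rewrite -E addrC addKr.
    split; first by congr pair; rewrite subrr.
    have := congr1 snd E'; have := congr1 snd E; rewrite /= => <- <-.
    by rewrite [c + _]addrC addrK.
  have ec : e - c != 0 by apply: contraNneq z0; rewrite Ez => ->.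
  have -> : C' = translate C (c' - c).
    by apply: (uniq_Vert _ _ _ _ _ ec CV CV' cC _ cC'); rewrite -?Ee // addrC subrK.
  rewrite /vertical /translate -!imset_comp; apply: eq_imset => x /=.
  by congr pair; rewrite /= ?subrr ?addr0.
have [i [j [Eu Ez]]] := block_difference uW vW.
have [i' [j' [Eu' Ez']]] := block_difference uW' vW'.
have ij : i != j by apply: contraNneq z0 => e; rewrite Ez e !subrr scale0r mulr0.
have ij' : i' != j' by apply: contraNneq z0 => e; rewrite Ez' e !subrr scale0r mulr0.
have X0 : X b j - X b i != 0 by rewrite subr_eq0; apply: contraNneq ij => /X_inj ->.
have X0' : X b' j' - X b' i' != 0 by rewrite subr_eq0; apply: contraNneq ij' => /X_inj ->.
have [Ev Ey] : (X b j - X b i) *: d = (X b' j' - X b' i') *: d' /\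
   l * (Y b j - Y b i) = l' * (Y b' j' - Y b' i').
  by move: Ez'; rewrite Ez => -[-> ->].
have Ec : (X b j - X b i) ^+ M * tau l = (X b' j' - X b' i') ^+ M * tau l'.
  by rewrite -cl -cl' -!colZ // Ev.
have same : b = b' -> (i', j') = (i, j) -> base_block b' d' l' = translate (base_block b d l) (u' - u).
  move=> eb [ei ej]; subst b' i' j'.
  have ed : d = d' by move/(scalerI X0): Ev.
  have el : l = l'.
    by apply: tau_inj; rewrite ?inE //; move/(mulfI (expf_neq0 M X0)): Ec.
  by rewrite Eu Eu' ed el subrr translate0.
have flipped : b = b' -> sym b -> (i', j') = (flip i, flip j) ->
    base_block b' d' l' = translate (base_block b d l) (u' - u).
  move=> eb sb [ei ej]; subst b' i' j'.
  have Xf : X b (flip j) - X b (flip i) = - (X b j - X b i) by rewrite !X_flip // opprB opprK addrC.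
  have ed : d' = - d.
    by apply: (scalerI X0); rewrite scalerN Ev Xf scaleNr opprK.
  have el : l = l'.
    apply: tau_inj; rewrite ?inE //; rewrite -cl -cl' ed -scaleN1r colZ ?oppr_eq0 ?oner_neq0 //.
    by rewrite -signr_odd (negPf M_even) expr0 mul1r.
  by rewrite Eu Eu' ed el block_flip // X_flip // Y_flip // scalerN scaleNr opprK subrr translate0.
have [Yij|Yij] := eqVneq (Y b i) (Y b j).
  have Yij' : Y b' i' = Y b' j'.
    move/eqP: Ey; rewrite Yij subrr mulr0 eq_sym mulf_eq0 (negPf l'0) subr_eq0 => /eqP; by [].
  have [sb ej] := Y_eq ij Yij; have [sb' ej'] := Y_eq ij' Yij'.
  have [| | |eb] := @loop_inj b i b' i' sb sb'.
  - by rewrite -ej.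
  - by rewrite -ej'.
  - have := congr1 (fun x => x ^+ s) Ec; rewrite !exprMn !tau_root // !mulr1 -!exprM.
    by rewrite -ej -ej'.
  by case=> ei; [apply: same|apply: flipped] => //; rewrite ej' ei ej.
have Yij' : Y b' i' != Y b' j'.
  apply: contraNneq Yij => e; move/eqP: Ey; rewrite e subrr mulr0 mulf_eq0 (negPf l0) subr_eq0 /=.
  by rewrite eq_sym.
have [|eb] := colour_inj Yij Yij'.
  have tY : tau (Y b j - Y b i) * tau l = tau (Y b' j' - Y b' i') * tau l'.
    by rewrite -!tauM mulrC Ey mulrC.
  have Yn : Y b j - Y b i != 0 by rewrite subr_eq0 eq_sym.
  have Yn' : Y b' j' - Y b' i' != 0 by rewrite subr_eq0 eq_sym.
  apply/eqP; rewrite /base_colour eqr_div ?tau_neq0 //; apply/eqP.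
  apply: (mulIf (mulf_neq0 (tau_neq0 l0) (tau_neq0 l'0))).
  rewrite mulrACA Ec -tY; ring.
by case=> [e|[sb e]]; [apply: same|apply: flipped].
Qed.

Lemma family_difference_family : difference_family k family.
Proof.
by split; [exact: card_family|exact: cover_family|exact: uniq_family].
Qed.

End Family.

(** * Cyclotomic difference families *)

Lemma eq_card_bij (T T' : finType) (A : {set T}) (B : {set T'}) (b0 : T') : #|A| = #|B| ->
  exists f : T -> T', {in A &, injective f} /\ f @: A = B.
Proof.
move=> AB; pose f x := nth b0 (enum B) (index x (enum A)).
have fi : {in A &, injective f}.
  move=> x y xA yA /eqP; rewrite nth_uniq ?enum_uniq -?cardE -?AB ?cardE ?index_mem ?mem_enum //.
  by move/eqP/(congr1 (nth x (enum A))); rewrite !nth_index ?mem_enum.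
exists f; split=> //; apply/eqP; rewrite eqEcard (card_in_imset fi) AB leqnn andbT.
apply/subsetP=> _ /imsetP[x xA ->]; rewrite -mem_enum mem_nth //.
by rewrite -cardE -AB cardE index_mem mem_enum.
Qed.

Section Pairs.
Variable P : finType.
Definition rank_lt (p : P * P) := (enum_rank p.1 < enum_rank p.2)%N.
Definition ordered_pairs := [set p | rank_lt p].

Lemma card_ordered_pairs : #|ordered_pairs| = 'C(#|P|, 2).
Proof.
rewrite -bin2_sum big_mkord -sum1_card.
rewrite (partition_big (fun p : P * P => p.2) xpredT) //=.
have E j : (\sum_(p in ordered_pairs | p.2 == j) 1 = enum_rank j)%N.
  rewrite sum1_card -[RHS]card_ord.
  have wid : (enum_rank j <= #|P|)%N by exact: ltnW.
  rewrite -(card_imset (f := fun i : 'I_(enum_rank j) => (enum_val (widen_ord wid i), j))); last first.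
    by move=> i i' [] /enum_val_inj /(congr1 val) /= /ord_inj.
  apply: eq_card => -[i i']; rewrite unfold_in inE /rank_lt /=; apply/andP/imsetP.
    case=> + /eqP ei; rewrite ei => lt; exists (Ordinal lt) => //; congr pair.
    by apply: enum_rank_inj; apply: ord_inj; rewrite enum_valK.
  by case=> x _ [-> ->]; rewrite enum_valK /=.
rewrite (eq_bigr _ (fun j _ => E j)) (reindex _ (onW_bij _ (@enum_val_bij P))).
by apply: eq_bigr => j _; rewrite enum_valK.
Qed.

Lemma rank_lt_total (i j : P) : i != j -> rank_lt (i, j) \/ rank_lt (j, i).
Proof.
move=> ij; have [||/ord_inj/enum_rank_inj/eqP] := ltngtP (enum_rank i) (enum_rank j).
- by left.
- by right.
- by rewrite (negPf ij).
Qed.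

Lemma prescribed_differences_fin (N : nat) : exists Q, forall (K : finFieldType) (M : nat),
  (M * N)%N = #|K|.-1 -> (Q <= #|K|)%N ->
  forall kappa : P * P -> K, (forall p, rank_lt p -> kappa p ^+ N = 1) ->
  exists x : P -> K, forall i j, rank_lt (i, j) -> (x j - x i) ^+ M = kappa (i, j).
Proof.
have [Q HQ] := prescribed_differences N #|P|.
exists Q => K M MN qQ kappa hk.
(* The value 1 away from the ordered pairs is a root of unity, as [prescribed_differences] asks of
   all indices. *)
pose kap (i j : nat) : K := if insub i is Some i' then
  if insub j is Some j' then
  let p := (enum_val (i' : 'I_#|P|), enum_val (j' : 'I_#|P|)) in
  if rank_lt p then kappa p else 1 else 1 else 1.
have [|x hx] := HQ K M MN qQ kap.
  move=> i j; rewrite /kap; case: insub => [i'|]; rewrite ?expr1n //.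
  by case: insub => [j'|]; rewrite ?expr1n //; case: ifP => [/hk //|_]; rewrite expr1n.
exists (fun i => x (enum_rank i)) => i j ij; rewrite hx; last by rewrite ltn_ord andbT.
by rewrite /kap !valK /= !enum_rankK ij.
Qed.

End Pairs.

(* An arbitrary choice of one element of each pair {x, -x}. *)
Definition positive (K : finFieldType) (x : K) := (enum_rank x < enum_rank (- x)%R)%N.

Lemma positiveN (K : finFieldType) (x : K) : 2%:R != 0 :> K -> x != 0 ->
  positive (- x) = ~~ positive x.
Proof.
move=> t0 x0; rewrite /positive opprK.
have : x != - x by rewrite -subr_eq0 opprK -mulr2n -mulr_natl mulf_neq0.
move: (enum_rank_inj (x1 := x) (x2 := - x)).
by case: ltngtP => // /ord_inj E h; rewrite -(h (esym E)) eqxx.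
Qed.

Lemma card_half (K : finFieldType) (L : {set K}) : 2%:R != 0 :> K -> 0 \notin L ->
  (forall x, x \in L -> - x \in L) -> #|L| = (#|[set x in L | positive x]|.*2)%N.
Proof.
move=> t0 L0 LN; rewrite -(cardsID [set x : K | positive x] L) -addnn; congr addn.
  by apply: eq_card => x; rewrite !inE.
rewrite -(card_imset (mem [set x in L | positive x]) (@oppr_inj K)).
apply: eq_card => x; rewrite !inE; apply/andP/imsetP.
  case=> np xL; exists (- x); rewrite ?opprK // !inE LN // positiveN ?np //.
  by apply: contraNneq L0 => <-.
case=> y; rewrite !inE => /andP[yL py] ->; rewrite LN // positiveN // ?py //.
by apply: contraNneq L0 => <-.
Qed.

(** Choose x_i for which the powers (x_j - x_i)^M, i < j, are the 'C(k, 2)-th roots of unity, each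
    once. Then z^M names a pair with z = h (x_j - x_i) and h^M = 1, and the blocks are the multiples
    of {x_i} by such h. *)
Lemma field_difference_family (k : nat) : (1 < k)%N ->
  exists Q, forall (F : finFieldType) (M : nat), (M * 'C(k, 2))%N = #|F|.-1 -> ~~ odd M ->
  2%:R != 0 :> F -> (Q <= #|F|)%N ->
  exists Vert : {set {set F}}, difference_family k Vert.
Proof.
move=> k1; have [Q HQ] := prescribed_differences_fin 'I_k 'C(k, 2).
exists Q => F M MN Mev t0 FQ; set N := 'C(k, 2) in MN HQ.
have [phi [phi_inj phiE]] : exists f : 'I_k * 'I_k -> F,
    {in ordered_pairs 'I_k &, injective f} /\ f @: ordered_pairs 'I_k = [set x | x ^+ N == 1].
  by apply: (eq_card_bij (1 : F)); rewrite (card_roots_of_unity MN) card_ordered_pairs card_ord.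
have phiN p : rank_lt p -> phi p ^+ N = 1.
  move=> lt; have : phi p \in phi @: ordered_pairs 'I_k by rewrite imset_f ?inE.
  by rewrite phiE inE => /eqP.
have [x hx] := HQ F M MN FQ phi phiN.
have [M0 N0] := card_pred_factors_gt0 MN.
have even z : (- z) ^+ M = z ^+ M :> F.
  by rewrite exprNn -signr_odd (negPf Mev) mul1r.
have xd p : rank_lt p -> x p.2 - x p.1 != 0.
  case: p => i j lt; apply: contraTneq isT => /= e; have := phiN _ lt; rewrite -hx // e.
  by move/eqP; rewrite !expr0n eqn0Ngt M0 expr0n eqn0Ngt N0 eq_sym oner_eq0.
have x_inj : injective x.
  move=> i j e; apply/eqP/negPn/negP=> ij.
  by case: (rank_lt_total ij) => /xd; rewrite /= e subrr eqxx.
(* As M is even, -h is an M-th root of unity with h. Both multiples have the same differences, so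
   only one is kept. *)
pose R := [set h : F | (h ^+ M == 1) && positive h].
have R0 h : h \in R -> h != 0.
  by rewrite inE => /andP[/eqP h1 _]; apply: root_of_unity_neq0 h1.
pose blk h := [set h * x i | i : 'I_k].
exists [set blk h | h in R]; split.
- move=> _ /imsetP[h hR ->]; rewrite card_imset ?card_ord // => i j /(mulfI (R0 _ hR)); exact: x_inj.
- move=> z z0.
  have : z ^+ M \in phi @: ordered_pairs 'I_k by rewrite phiE inE -exprM MN expf_card_pred.
  case/imsetP=> -[i j]; rewrite inE => lt E.
  have d0 := xd _ lt; rewrite /= in d0.
  pose h := z / (x j - x i).
  have h1 : h ^+ M = 1 by rewrite expr_div_n hx // -E divff // expf_neq0.
  have h0 : h != 0 by rewrite mulf_neq0 ?invr_eq0.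
  have [hp|hp] := boolP (positive h).
    exists (blk h), (h * x i); split; first by apply: imset_f; rewrite inE h1 eqxx.
      exact: imset_f.
    apply/imsetP; exists j => //; rewrite -[z](divfK d0) -/h; ring.
  exists (blk (- h)), (- h * x j); split.
  + by apply: imset_f; rewrite inE even h1 eqxx positiveN.
  + exact: imset_f.
  + apply/imsetP; exists i => //; rewrite -[z](divfK d0) -/h; ring.
- move=> z W W' u u' z0 /imsetP[h hR ->] /imsetP[h' hR' ->].
  move=> /imsetP[i _ ->] /imsetP[j _ Ej] /imsetP[i' _ ->] /imsetP[j' _ Ej'].
  have Ez : z = h * (x j - x i) by rewrite mulrBr -Ej addrC addKr.
  have Ez' : z = h' * (x j' - x i') by rewrite mulrBr -Ej' addrC addKr.
  have ij : i != j by apply: contraNneq z0 => e; rewrite Ez e subrr mulr0.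
  have ij' : i' != j' by apply: contraNneq z0 => e; rewrite Ez' e subrr mulr0.
  have [h1 h1'] : h ^+ M = 1 /\ h' ^+ M = 1.
    by move: hR hR'; rewrite !inE => /andP[/eqP-> _] /andP[/eqP-> _].
  have EM : (x j - x i) ^+ M = (x j' - x i') ^+ M.
    by have := congr1 (fun y => y ^+ M) Ez'; rewrite /= Ez !exprMn h1 h1' !mul1r.
  pose o (i j : 'I_k) := if rank_lt (i, j) then (i, j) else (j, i).
  have oE a b : a != b -> o a b \in ordered_pairs 'I_k /\ (x b - x a) ^+ M = phi (o a b).
    move=> ab; rewrite /o inE; case: ifP => lt; first by rewrite lt hx.
    have lt' : rank_lt (b, a) by case: (rank_lt_total ab) => //; rewrite lt.
    by rewrite lt' -hx // -even opprB.
  have [o1 p1] := oE _ _ ij; have [o2 p2] := oE _ _ ij'.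
  have : o i j = o i' j' by apply: phi_inj => //; rewrite -p1 -p2.
  have d0 : x j - x i != 0 by apply: contraNneq z0 => e; rewrite Ez e mulr0.
  have oo : o i j = o i' j' -> (i', j') = (i, j) \/ (i', j') = (j, i).
    by rewrite /o; case: ifP; case: ifP => _ _ [-> ->]; [left|right|right|left].
  case/oo=> -[ei ej]; subst i' j'.
    have -> : h' = h by apply: (mulIf d0); rewrite -Ez' -Ez.
    by rewrite subrr translate0.
  have eh : h' = - h by apply: (mulIf d0); rewrite mulNr -Ez Ez' -mulrN opprB.
  move: hR hR'; rewrite eh !inE => /andP[h1p hp] /andP[_]; rewrite positiveN ?hp // .
  by apply: R0; rewrite inE h1p hp.
Qed.

(** * Construction of the base blocks *)

(* The positions in a block of size 2w + 1; in a symmetric block, [None] is the centre. *)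
Definition Pos (w : nat) := option ('I_w * bool).
Definition flip (w : nat) (i : Pos w) : Pos w := if i is Some (m, t) then Some (m, ~~ t) else None.

Lemma flip_neq w (i : Pos w) : (i != flip i) = (i != None).
Proof. by case: i => [[m t]|] //=; apply/eqP=> -[]; case: t. Qed.

Lemma card_Pos w : #|{: Pos w}| = w.*2.+1.
Proof. by rewrite card_option card_prod card_ord card_bool muln2. Qed.

Section Base.
Variables (w : nat).
Let k := w.*2.+1.
(** One index for each of the w pairs {a_p, -a_p} in each of the k symmetric blocks; n is also 'C(k,
    2). *)
Let n := #|{: 'I_k * 'I_w}|.
Variables (K F : finFieldType) (M s : nat).
Hypothesis MN : (M * (n * s))%N = #|K|.-1.
Hypothesis M_even : ~~ odd M.
Hypotheses (K2 : 2%:R != 0 :> K) (F2 : 2%:R != 0 :> F).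
Variable tau : F -> K.
Hypothesis tauM : {morph tau : x y / x * y}.
Hypothesis tau_inj : {in predC1 0 &, injective tau}.
Hypothesis tau_root : forall y, y != 0 -> tau y ^+ s = 1.

Let s_gt0 : (0 < s)%N.
Proof. by have [_ /[!muln_gt0]/andP[]] := card_pred_factors_gt0 MN. Qed.
Let M_gt0 : (0 < M)%N := (card_pred_factors_gt0 MN).1.

Let tau_neq0 y : y != 0 -> tau y != 0.
Proof. by move/tau_root; apply: root_of_unity_neq0. Qed.

(** tau (-1) is a square root of 1, and it is not 1 because tau is injective. *)
Lemma tauN y : y != 0 -> tau (- y) = - tau y.
Proof.
move=> y0; have t1 : tau 1 = 1.
  apply: (mulfI (tau_neq0 (oner_neq0 F))); by rewrite -tauM !mulr1.
have : tau (-1) ^+ 2 == 1 by rewrite expr2 -tauM mulrNN mulr1 t1.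
rewrite sqrf_eq1 => /orP[/eqP|/eqP] E; last by rewrite -mulN1r tauM E mulN1r.
have /eqP : - 1 = 1 :> F by apply: tau_inj; rewrite ?inE ?oppr_eq0 ?oner_neq0 // E t1.
by rewrite eq_sym -subr_eq0 opprK (negPf F2).
Qed.

Lemma expM_sign (e : bool) (x : K) : ((-1) ^+ e * x) ^+ M = x ^+ M.
Proof. by rewrite exprMn -exprM mulnC exprM -[(-1) ^+ M]signr_odd (negPf M_even) expr0 expr1n mul1r. Qed.

Definition diff_colour (x x' : K) (y y' : F) := (x' - x) ^+ M / tau (y' - y).

Lemma diff_colourC x x' y y' : y != y' -> diff_colour x' x y' y = - diff_colour x x' y y'.
Proof.
move=> yy; rewrite /diff_colour -[x - x']opprB -[y - y']opprB tauN ?subr_eq0 1?eq_sym //.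
by rewrite -[- (x' - x)]mulN1r -[-1]expr1 (expM_sign true) invrN mulrN.
Qed.

Lemma diff_colour_root x x' y y' : x != x' -> y != y' -> diff_colour x x' y y' ^+ (n * s) = 1.
Proof.
move=> xx yy; rewrite expr_div_n -exprM MN expf_card_pred ?subr_eq0 1?eq_sym //.
by rewrite mulnC exprM tau_root ?subr_eq0 1?eq_sym // expr1n divr1.
Qed.

(** * The symmetric blocks and their colours *)

Local Notation Sh := (option ('I_n * bool)).
Variable b : 'I_n -> F.
Hypotheses (b_inj : injective b) (b_neq0 : forall p, b p != 0).
Definition level (u : Sh) : F := if u is Some (p, _) then b p else 0.
(* The value 1 is a dummy that keeps the factor invertible for pairs of points on one level. *)
Definition level_factor (p : 'I_n) (u : Sh) : K :=
  if b p == level u then 1 else tau (b p - level u).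

Lemma level_factor_neq0 p u : level_factor p u != 0.
Proof.
rewrite /level_factor; case: ifP => h; first exact: oner_neq0.
by rewrite tau_neq0 // subr_eq0 h.
Qed.

Variables (omega : 'I_n -> K) (a : 'I_n -> K).
Hypothesis aP : spread M s level_factor omega n a.

(** Position (m, t) of block e stands for (-1)^t a_p, where p is the rank of (e, m). *)
Definition embed (e : 'I_k) (i : Pos w) : Sh :=
  if i is Some (m, t) then Some (enum_rank (e, m), t) else None.
Definition twist (t : bool) (u : Sh) : Sh := if u is Some (p, t') then Some (p, t (+) t') else None.
Definition symX e i := shift a (embed e i).
Definition symY e i := level (embed e i).

Lemma shift_twist t u : shift a (twist t u) = (-1) ^+ t * shift a u.
Proof. by case: u => [[p t']|] /=; rewrite ?mulr0 // signr_addb mulrA. Qed.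

Lemma symX_flip e i : symX e (flip i) = - symX e i.
Proof.
by case: i => [[m t]|]; rewrite /symX /= ?oppr0 //; case: t; rewrite /= ?expr0 ?expr1 ?mul1r ?mulN1r ?opprK.
Qed.

Lemma symY_flip e i : symY e (flip i) = symY e i.
Proof. by case: i => [[m t]|]. Qed.

Lemma symY_eq e i j : (symY e i == symY e j) = (j \in [set i; flip i]).
Proof.
rewrite !inE; case: i => [[m t]|]; case: j => [[m' t']|]; rewrite /symY //=.
- rewrite (inj_eq b_inj) (inj_eq enum_rank_inj) !xpair_eqE eqxx /=.
  have SomeE (x y : 'I_w * bool) : (Some x == Some y) = (x == y) by [].
  by rewrite !SomeE !xpair_eqE [m' == m]eq_sym -andb_orr; case: t t' => [] []; rewrite ?andbT.
- by rewrite (negPf (b_neq0 _)).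
- by rewrite eq_sym (negPf (b_neq0 _)).
- by rewrite eqxx.
Qed.

Lemma embed_inj e : injective (embed e).
Proof. by case=> [[m t]|] [[m' t']|] //= [] /enum_rank_inj [-> ->]. Qed.

Lemma symX_inj e : injective (symX e).
Proof.
move=> i j E; apply/eqP/negPn/negP=> ij; move/eqP: E; apply/negP.
apply: (shift_inj K2 aP); rewrite ?(inj_eq (@embed_inj e)) //.
  by case: i {ij} => [[m t]|] /=.
by case: j {ij} => [[m t]|] /=.
Qed.

(* Flipping both points, the pair (i, j) of the symmetric block e becomes (u, (q, +)), to which
   the greedy choice of a applies. *)
Definition encodes e i j (q : 'I_n) (u : Sh) :=
  exists m t, [/\ j = Some (m, t), q = enum_rank (e, m), u = twist t (embed e i) & below q u].

(** q determines e, and j up to a flip; for each of the two signs of j, u determines i. *)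
Lemma encodes_inj e i j e' i' j' q u : encodes e i j q u -> encodes e' i' j' q u ->
  e = e' /\ ((i', j') = (i, j) \/ (i', j') = (flip i, flip j)).
Proof.
move=> [m [t [-> -> -> _]]] [m' [t' [-> /enum_rank_inj [<- <-] E _]]]; split=> //.
have [tt|tt] := eqVneq t t'; [left|right].
  congr pair; rewrite ?tt //; apply: (@embed_inj e); move: E; rewrite -tt.
  case: (embed e i) => [[p x]|]; case: (embed e i') => [[p' x']|] //= [-> /addbI ->]; by [].
have -> : t' = ~~ t by case: t t' tt {E} => [] [].
congr pair; apply: (@embed_inj e).
have -> : embed e (flip i) = twist true (embed e i) by case: i {E} => [[? ?]|].
move: E; case: (embed e i) => [[p x]|]; case: (embed e i') => [[p' x']|] //= [-> xx].
by congr (Some (_, _)); case: t t' x x' xx tt => [] [] [] [].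
Qed.

(** Multiplying both points by (-1)^t changes no colour, as M is even and levels do not depend on
    the sign. *)
Lemma encode_colour e i j q u : encodes e i j q u ->
  diff_colour (symX e i) (symX e j) (symY e i) (symY e j) = colour M level_factor a q u.
Proof.
move=> [m [t [-> -> -> lt]]]; set q0 := enum_rank _ in lt *; rewrite /diff_colour /colour.
have lev : level (twist t (embed e i)) = level (embed e i) by case: (embed e i) => [[]|].
have ne : b q0 != level (embed e i).
  move: lt; case: (embed e i) => [[p x]|] //= lt; rewrite (inj_eq b_inj).
  by apply: contraTneq lt => ->; rewrite ltnn.
congr (_ / _); last by rewrite /level_factor lev (negPf ne).
rewrite shift_twist /symX /= -/q0 -(expM_sign t (a q0 - _)) mulrBr mulrA -signr_addb addbb mul1r.
by rewrite -/q0.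
Qed.

(** The position with the larger index plays the part of the new point. [sg] records that this is i,
    so that the pair is reversed and its colour negated. *)
Lemma sym_encode e i j : symY e i != symY e j -> exists (q : 'I_n) (u : Sh) (sg : bool),
  [/\ below q u, if sg then encodes e j i q u else encodes e i j q u &
   diff_colour (symX e i) (symX e j) (symY e i) (symY e j) = (-1) ^+ sg * colour M level_factor a q u].
Proof.
have fwd i' j' q u : encodes e i' j' q u -> exists (q : 'I_n) (u : Sh) (sg : bool),
  [/\ below q u, if sg then encodes e j' i' q u else encodes e i' j' q u &
   diff_colour (symX e i') (symX e j') (symY e i') (symY e j') = (-1) ^+ sg * colour M level_factor a q u].
  move=> h; exists q, u, false; split=> //; last by rewrite (encode_colour h) expr0 mul1r.
  by case: h => [m [t []]].
have bwd i' j' q u : symY e i' != symY e j' -> encodes e j' i' q u -> exists (q : 'I_n) (u : Sh) (sg : bool),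
  [/\ below q u, if sg then encodes e j' i' q u else encodes e i' j' q u &
   diff_colour (symX e i') (symX e j') (symY e i') (symY e j') = (-1) ^+ sg * colour M level_factor a q u].
  move=> ne h; exists q, u, true; split=> //; first by case: h => [m [t []]].
  by rewrite diff_colourC 1?eq_sym // (encode_colour h) expr1 mulN1r.
case: i j => [[m t]|] [[m' t']|] ne.
- have [lt|lt|/ord_inj/enum_rank_inj [E]] := ltngtP (enum_rank (e, m)) (enum_rank (e, m')).
  + by apply: (fwd _ _ (enum_rank (e, m')) (twist t' (embed e (Some (m, t))))); exists m', t'; split.
  + by apply: (bwd _ _ (enum_rank (e, m)) (twist t (embed e (Some (m', t'))))) => //; exists m, t; split.
  + by move: ne; rewrite E /symY /= eqxx.
- by apply: (bwd _ _ (enum_rank (e, m)) (twist t (embed e None))) => //; exists m, t; split.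
- by apply: (fwd _ _ (enum_rank (e, m')) (twist t' (embed e None))); exists m', t'; split.
- by move: ne; rewrite eqxx.
Qed.

Lemma sym_colour_inj e i j e' i' j' : symY e i != symY e j -> symY e' i' != symY e' j' ->
  diff_colour (symX e i) (symX e j) (symY e i) (symY e j) =
  diff_colour (symX e' i') (symX e' j') (symY e' i') (symY e' j') ->
  e = e' /\ ((i', j') = (i, j) \/ (i', j') = (flip i, flip j)).
Proof.
have [_ nz inj] := aP.
move=> /sym_encode[q [u [sg [bu en ->]]]] /sym_encode[q' [u' [sg' [bu' en' ->]]]] E.
have c0 : colour M level_factor a q u != 0.
  by rewrite mulf_neq0 ?invr_eq0 ?level_factor_neq0 // expf_neq0 // subr_eq0 nz.
have E2 : colour M level_factor a q u = (-1) ^+ (sg (+) sg') * colour M level_factor a q' u'.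
  by rewrite signr_addb -mulrA -E mulrA -signr_addb addbb mul1r.
have [eq eu] := inj _ _ _ _ _ (ltn_ord q) (ltn_ord q') bu bu' E2.
(* Opposite signs would make a nonzero colour equal to its negative. *)
have es : sg = sg'.
  move: E2; rewrite -eq -eu; case: sg sg' {E en en'} => [] [] //= /eqP;
  by rewrite expr1 mulN1r -subr_eq0 opprK -mulr2n -mulr_natl mulf_eq0 (negPf K2) (negPf c0).
move: en en'; rewrite -eq -eu -es; case: sg {E E2 es} => en en'.
  by have [-> [[-> ->]|[-> ->]]] := encodes_inj en en'; split; auto.
exact: encodes_inj en en'.
Qed.

Let symT := [set t : 'I_k * (Pos w * Pos w) | symY t.1 t.2.1 != symY t.1 t.2.2].
Let symC (t : 'I_k * (Pos w * Pos w)) :=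
  diff_colour (symX t.1 t.2.1) (symX t.1 t.2.2) (symY t.1 t.2.1) (symY t.1 t.2.2).
Definition sym_colours := symC @: symT.

(** In each block, k - 1 of the k (k - 1) ordered pairs of distinct positions join a position to its
    flip. *)
Lemma card_symT : #|symT| = (k * (k * (k - 1) - (k - 1)))%N.
Proof.
rewrite -sum1_card.
rewrite (eq_bigl (fun t => true && (symY t.1 t.2.1 != symY t.1 t.2.2))); last by move=> t; rewrite inE.
rewrite -(pair_big_dep xpredT (fun e p => symY e p.1 != symY e p.2) (fun _ _ => 1%N)) /=.
rewrite -[X in (X * _)%N]card_ord -sum_nat_const; apply: eq_bigr => e _.
rewrite -(pair_big_dep xpredT (fun i j => symY e i != symY e j) (fun _ _ => 1%N)) /=.
under eq_bigr => i _.
  rewrite sum1_card (eq_card (B := ~: [set i; flip i])); last first.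
    by move=> j; rewrite [RHS]inE -(symY_eq e).
  over.
have E (i : Pos w) : #|~: [set i; flip i]| = (k - 1 - (i != None))%N.
  by have := cardsC [set i; flip i]; rewrite cards2 flip_neq card_Pos -/k; case: (i != None) => /=; lia.
rewrite (eq_bigr _ (fun i _ => E i)) (bigD1 None) //=.
rewrite (eq_bigr (fun _ => (k - 2)%N)); last by move=> i ->; rewrite /= -subnDA.
rewrite sum_nat_const (eq_card (B := predC1 None)); last by move=> i; rewrite !inE.
have := cardC1 (None : Pos w); rewrite card_Pos => ->.
rewrite /k; nia.
Qed.

(** By [sym_colour_inj] a fibre of [symC] consists of (i, j) and (flip i, flip j), which differ as i
    and j are not both the centre. *)
Lemma card_sym_colours : (#|sym_colours| * 2 = #|symT|)%N.
Proof.
rewrite -sum_nat_const -sum1_card.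
rewrite [RHS](partition_big symC (mem sym_colours)) /=; last by move=> t tT; apply: imset_f.
apply: eq_bigr => x /imsetP[[e [i j]] tT ->]; rewrite sum1_card.
have ne : (e, (i, j)) != (e, (flip i, flip j)).
  rewrite !xpair_eqE eqxx /= negb_and !flip_neq -negb_and; apply: contraTN tT.
  by case/andP=> /eqP -> /eqP ->; rewrite inE eqxx.
have <- : #|[set (e, (i, j)); (e, (flip i, flip j))]| = 2%N by rewrite cards2 ne.
apply: eq_card => -[e' [i' j']]; rewrite [RHS]unfold_in !inE /symC /=.
have cf : diff_colour (symX e (flip i)) (symX e (flip j)) (symY e (flip i)) (symY e (flip j)) =
    diff_colour (symX e i) (symX e j) (symY e i) (symY e j).
  by rewrite /diff_colour !symX_flip !symY_flip -opprD -mulN1r -[-1]expr1 (expM_sign true).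
rewrite inE /= in tT.
apply/orP/andP.
  by case=> /eqP[-> -> ->]; rewrite ?cf ?eqxx ?symY_flip.
case=> ne' /eqP E; have [<- [[-> ->]|[-> ->]]] := sym_colour_inj tT ne' (esym E); rewrite eqxx; auto.
Qed.

Lemma sym_coloursN x : x \in sym_colours -> - x \in sym_colours.
Proof.
case/imsetP=> -[e [i j]]; rewrite inE /= => ne ->; apply/imsetP; exists (e, (j, i)).
  by rewrite inE /= eq_sym.
by rewrite /symC /= -diff_colourC.
Qed.

Lemma symX_neq e i j : symY e i != symY e j -> symX e i != symX e j.
Proof. by apply: contraNneq => /symX_inj ->. Qed.

Lemma sym_colours_root x : x \in sym_colours -> x ^+ (n * s) = 1.
Proof.
case/imsetP=> -[e [i j]]; rewrite inE /= => ne ->.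
by rewrite /symC diff_colour_root ?symX_neq.
Qed.

(** * The remaining colours and the blocks with distinct second coordinates *)

Variable nu : nat.
Hypothesis s_nu : s = ((w + nu).*2)%N.
Hypothesis w_gt0 : (0 < w)%N.
Hypothesis prescribed : forall kappa : Pos w * Pos w -> K,
  (forall p, rank_lt p -> kappa p ^+ (n * s) = 1) ->
  exists x : Pos w -> K, forall i j, rank_lt (i, j) -> (x j - x i) ^+ M = kappa (i, j).
Variable y : Pos w -> F.
Hypothesis y_inj : injective y.
Hypotheses (omega_inj : injective omega)
  (omega_surj : forall x : K, x ^+ n = 1 -> exists p, omega p = x).

Definition free_colours := [set x : K | x ^+ (n * s) == 1] :\: sym_colours.
Let half := [set x in free_colours | positive x].
Let slots := [set t : 'I_nu * (Pos w * Pos w) | rank_lt t.2].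

Lemma card_n : n = (k * w)%N.
Proof. by rewrite /n card_prod !card_ord. Qed.

Lemma free0 : 0 \notin free_colours.
Proof.
rewrite !inE negb_and; apply/orP; right; rewrite expr0n eqn0Ngt muln_gt0 s_gt0 card_n /= muln_gt0 w_gt0 /=.
by rewrite eq_sym oner_eq0.
Qed.

Lemma freeN x : x \in free_colours -> - x \in free_colours.
Proof.
rewrite !inE => /andP[xS /eqP x1]; apply/andP; split.
  by apply: contra xS => /sym_coloursN; rewrite opprK.
by rewrite exprNn x1 mulr1 -signr_odd oddM s_nu odd_double andbF expr0.
Qed.

(** Of the n s colours the symmetric blocks use 2 k w^2, which by [s_nu] leaves 2 nu k w, or nu k w
    up to sign. Each of the nu further blocks has 'C(k, 2) = k w pairs of positions. *)
Lemma card_slots_half : #|slots| = #|half|.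
Proof.
have <- : setX [set: 'I_nu] (ordered_pairs (Pos w)) = slots.
  by apply/setP=> -[f p]; rewrite !inE.
rewrite cardsX cardsT card_ord card_ordered_pairs card_Pos.
have h1 := card_half K2 free0 freeN; rewrite -/half in h1.
have h2 : (#|free_colours| = n * s - #|sym_colours|)%N.
  rewrite /free_colours cardsD (card_roots_of_unity MN); congr (_ - _)%N.
  apply: eq_card => x; rewrite !inE andb_idl // => /sym_colours_root ->; exact: eqxx.
have h3 := card_sym_colours; rewrite card_symT in h3.
rewrite bin2odd; last by rewrite /= odd_double.
have -> : (k * (k.-1)./2 = k * w)%N by rewrite /k /= doubleK.
have k1 : (k - 1 = 2 * w)%N by rewrite /k subn1 /= mul2n.
have e1 : (k * (k * (k - 1) - (k - 1)) = k * w * w.*2 * 2)%N.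
  have -> : (k * (k - 1) - (k - 1) = (k - 1) * (k - 1))%N by rewrite -{2}[(k - 1)%N]mul1n -mulnBl.
  by rewrite k1 -mul2n; ring.
have e2 : (n * s = nu * (k * w) * 2 + k * w * w.*2)%N.
  by rewrite card_n s_nu -!mul2n; ring.
move: h3 h2; rewrite e1 e2 => /eqP; rewrite eqn_pmul2r // => /eqP ->; rewrite addnK h1.
by rewrite -muln2 => /eqP; rewrite eqn_pmul2r // => /eqP ->.
Qed.

(** Distribute the colours of [half] bijectively over the slots. Since the second coordinates y are
    fixed in advance, this prescribes the powers (x_j - x_i)^M in each block. *)
Lemma transversals_exist : exists (xs : 'I_nu -> Pos w -> K) (phi : 'I_nu * (Pos w * Pos w) -> K),
  [/\ {in slots &, injective phi}, phi @: slots = half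
    & forall f i j, rank_lt (i, j) -> diff_colour (xs f i) (xs f j) (y i) (y j) = phi (f, (i, j))].
Proof.
have [phi [phi_inj phiE]] := eq_card_bij (1 : K) card_slots_half.
have H f : exists x : Pos w -> K, forall i j, rank_lt (i, j) ->
    diff_colour (x i) (x j) (y i) (y j) = phi (f, (i, j)).
  have yd p : rank_lt p -> y p.2 - y p.1 != 0.
    case: p => i j lt; rewrite subr_eq0 (inj_eq y_inj) /=; apply: contraTneq lt => ->.
    by rewrite /rank_lt /= ltnn.
  have [|x hx] := prescribed (kappa := fun p => phi (f, p) * tau (y p.2 - y p.1)).
    move=> p lt; have : phi (f, p) \in half by rewrite -phiE imset_f // inE.
    rewrite !inE => /andP[/andP[_ /eqP h] _].
    by rewrite exprMn h mulnC exprM tau_root ?yd // expr1n mulr1.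
  exists x => i j lt; rewrite /diff_colour hx //= mulfK // tau_neq0 //.
  exact: (yd (i, j)).
by have [xs hxs] := fin_all_exists H; exists xs, phi.
Qed.

Local Notation Base := ('I_k + 'I_nu)%type.
Definition is_sym (c : Base) : bool := if c is inl _ then true else false.

(** [inl] gives the k symmetric blocks, [inr] the nu others. The two kinds share no colour by the
    choice of [free_colours]; in the second kind a colour determines its sign and slot, hence the
    ordered pair. *)
Lemma base_family_exists : exists (X : Base -> Pos w -> K) (Y : Base -> Pos w -> F),
  [/\ [/\ forall c, injective (X c), forall c i, is_sym c -> X c (flip i) = - X c i,
          forall c i, is_sym c -> Y c (flip i) = Y c i
        & forall c i j, i != j -> Y c i = Y c j -> is_sym c /\ j = flip i],
     forall c i j c' i' j', Y c i != Y c j -> Y c' i' != Y c' j' ->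
      base_colour M tau X Y c i j = base_colour M tau X Y c' i' j' ->
      c = c' /\ ((i', j') = (i, j) \/ is_sym c /\ (i', j') = (flip i, flip j)),
     forall x : K, x ^+ (n * s) = 1 ->
      exists c i j, Y c i != Y c j /\ base_colour M tau X Y c i j = x,
     forall c i c' i', is_sym c -> is_sym c' -> i != flip i -> i' != flip i' ->
      (X c (flip i) - X c i) ^+ (M * s) = (X c' (flip i') - X c' i') ^+ (M * s) ->
      c = c' /\ (i' = i \/ i' = flip i)
   & forall x : K, x ^+ n = 1 ->
      exists c i, [/\ is_sym c, i != flip i & (X c (flip i) - X c i) ^+ (M * s) = x]].
Proof.
have [xs [phi [phi_inj phiE hphi]]] := transversals_exist.
pose X (c : Base) := match c with inl e => symX e | inr f => xs f end.
pose Y (c : Base) := match c with inl e => symY e | inr f => y end.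
have phi_half f i j : rank_lt (i, j) -> phi (f, (i, j)) \in half.
  by move=> lt; rewrite -phiE imset_f // inE.
have half0 x : x \in half -> x != 0.
  by rewrite inE => /andP[xf _]; apply: contraTneq xf => ->; exact: free0.
have xs_inj f : injective (xs f).
  move=> i j e; apply/eqP/negPn/negP=> ij.
  have E i' j' : rank_lt (i', j') -> xs f i' <> xs f j'.
    move=> lt e'; have := half0 _ (phi_half f _ _ lt); rewrite -hphi // /diff_colour e' subrr.
    by rewrite expr0n eqn0Ngt M_gt0 mul0r eqxx.
  by case: (rank_lt_total ij) => /E; apply; rewrite e.
have trans_colour f i j : i != j ->
   exists i' j' (sg : bool), [/\ rank_lt (i', j'), (i', j') = (if sg then (j, i) else (i, j))
     & diff_colour (xs f i) (xs f j) (y i) (y j) = (-1) ^+ sg * phi (f, (i', j'))].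
  move=> ij; case: (rank_lt_total ij) => lt.
    by exists i, j, false; rewrite expr0 mul1r hphi.
  by exists j, i, true; rewrite expr1 mulN1r -hphi // -diff_colourC // (inj_eq y_inj) eq_sym.
have half_sign x x' (e e' : bool) : x \in half -> x' \in half ->
    (-1) ^+ e * x = (-1) ^+ e' * x' -> e = e' /\ x = x'.
  move=> xh xh' E.
  have E2 : x = (-1) ^+ (e (+) e') * x' by rewrite signr_addb -mulrA -E mulrA -signr_addb addbb mul1r.
  have px : positive x by move: xh; rewrite inE => /andP[].
  have px' : positive x' by move: xh'; rewrite inE => /andP[].
  have [ee|ee] := eqVneq e e'; first by move: E2; rewrite ee addbb expr0 mul1r.
  move: E2; have -> : e (+) e' = true by case: e e' ee {E} => [] [].
  by rewrite expr1 mulN1r => E2; move: px; rewrite E2 (positiveN K2 (half0 _ xh')) px'.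
have free_sign x (e : bool) : x \in half -> (-1) ^+ e * x \in free_colours.
  rewrite inE => /andP[xf _]; case: e; rewrite ?expr0 ?mul1r // expr1 mulN1r; exact: freeN.
have sym_in e i j : symY e i != symY e j ->
    diff_colour (symX e i) (symX e j) (symY e i) (symY e j) \in sym_colours.
  by move=> ne; apply/imsetP; exists (e, (i, j)); rewrite ?inE.
have trans_in f i j : y i != y j -> diff_colour (xs f i) (xs f j) (y i) (y j) \notin sym_colours.
  rewrite (inj_eq y_inj) => /(trans_colour f)[i' [j' [sg [lt _ ->]]]].
  by have := free_sign _ sg (phi_half f _ _ lt); rewrite inE => /andP[].
(* The points a_p and -a_p differ by 2 a_p up to sign, and [omega p] is [a p ^+ (M * s)]. *)
have loop_value e i : i != flip i -> exists m t, i = Some (m, t) /\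
    (symX e (flip i) - symX e i) ^+ (M * s) = 2%:R ^+ (M * s) * omega (enum_rank (e, m)).
  case: i => [[m t]|]; last by rewrite eqxx.
  move=> _; exists m, t; split=> //; have [om _ _] := aP.
  have -> : symX e (flip (Some (m, t))) - symX e (Some (m, t)) =
      (-1) ^+ (~~ t) * (2%:R * a (enum_rank (e, m))).
    by rewrite symX_flip /symX /=; case: t; rewrite /= ?expr0 ?expr1; ring.
  by rewrite -om // -exprMn !(exprM _ M) expM_sign.
exists X, Y; split.
- split.
  + by case=> [e|f]; [exact: symX_inj|exact: xs_inj].
  + by case=> [e|f] i //= _; exact: symX_flip.
  + by case=> [e|f] i //= _; exact: symY_flip.
  + case=> [e|f] i j ij /= => [/eqP|/y_inj ij']; last by rewrite ij' eqxx in ij.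
    by rewrite symY_eq !inE eq_sym (negPf ij) => /eqP.
- case=> [e|f] i j [e'|f'] i' j' ne ne' E; rewrite /base_colour in E.
  + by have [-> [h|h]] := sym_colour_inj ne ne' E; split; auto.
  + by have := sym_in _ _ _ ne; rewrite /diff_colour E; move/negP: (trans_in f' _ _ ne').
  + by have := sym_in _ _ _ ne'; rewrite /diff_colour -E; move/negP: (trans_in f _ _ ne).
  + move: ne ne'; rewrite /= !(inj_eq y_inj) => /(trans_colour f)[a1 [a2 [sg [lt e1 h]]]].
    move=> /(trans_colour f')[a1' [a2' [sg' [lt' e1' h']]]].
    rewrite /diff_colour in h h'; rewrite h h' in E.
    have [es ep] := half_sign _ _ _ _ (phi_half f _ _ lt) (phi_half f' _ _ lt') E.
    have [ef ea eb] : (f, (a1, a2)) = (f', (a1', a2')) by apply: phi_inj; rewrite ?inE.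
    subst f' a1' a2' sg'; split=> //; left; move: e1'; rewrite e1.
    by case: sg {E h h' e1} => -[-> ->].
- move=> x x1; have [xs_|xs_] := boolP (x \in sym_colours).
    case/imsetP: xs_ => -[e [i j]]; rewrite inE /= => ne ->; by exists (inl e), i, j.
  have xf : x \in free_colours by rewrite !inE xs_ x1 eqxx.
  have [px|px] := boolP (positive x).
    have : x \in phi @: slots by rewrite phiE inE xf px.
    case/imsetP=> -[f [i j]]; rewrite inE /= => lt ->; exists (inr f), i, j.
    split; last by rewrite -hphi.
    by rewrite /= (inj_eq y_inj); apply: contraTneq lt => ->; rewrite /rank_lt /= ltnn.
  (* A free colour that is not positive belongs to a slot taken in reverse order. *)
  have : - x \in phi @: slots.
    by rewrite phiE inE freeN // positiveN // (contraTneq _ xf) // => ->; exact: free0.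
  case/imsetP=> -[f [i j]]; rewrite inE /= => lt Ex.
  have yij : y i != y j by rewrite (inj_eq y_inj); apply: contraTneq lt => ->; rewrite /rank_lt /= ltnn.
  exists (inr f), j, i; split; first by rewrite eq_sym.
  by rewrite -[x]opprK Ex -hphi // -diff_colourC.
- case=> [e|f] i [e'|f'] i' // _ _ hi hi' /=.
  have [m [t [-> ->]]] := loop_value e i hi; have [m' [t' [-> ->]]] := loop_value e' i' hi'.
  move/(mulfI (expf_neq0 _ K2))/omega_inj/enum_rank_inj => [<- <-]; split=> //.
  by case: t t' => [] []; auto.
- move=> x x1; have [|p Ep] := omega_surj (x := x / 2%:R ^+ (M * s)).
    by rewrite expr_div_n x1 -exprM -mulnA [(s * n)%N]mulnC MN expf_card_pred // divr1.
  case Em : (enum_val p) => [e m]; have nf : Some (m, true) != flip (Some (m, true)) by rewrite flip_neq.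
  have [m' [t' [[<- _] E]]] := loop_value e _ nf.
  exists (inl e), (Some (m, true)); split=> //; apply: etrans E _.
  by rewrite -Em enum_valK Ep mulrC divfK // expf_neq0.
Qed.

End Base.

(** * Assembling the design *)

Lemma exists_primitive_root (K : finFieldType) (M s : nat) : (M * s)%N = #|K|.-1 ->
  exists z : K, s.-primitive_root z.
Proof.
move=> MN.
have [_ s0] := card_pred_factors_gt0 MN.
have c : #|[set x : K | x ^+ s == 1]| = s by apply: (@card_fiber K s M); rewrite ?expr1n // mulnC.
have : has s.-primitive_root (enum [set x : K | x ^+ s == 1]).
  apply: has_prim_root => //; first by apply/allP=> x; rewrite mem_enum inE unity_rootE.
    exact: enum_uniq.
  by rewrite -cardE c.
by case/hasP=> z _ hz; exists z.
Qed.

(** By discrete logarithms: tau sends z^i to ze^i, where z generates F^* and ze has the same order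
    in K^*. *)
Lemma exists_multiplicative_embedding (K F : finFieldType) (M : nat) :
  (M * #|F|.-1)%N = #|K|.-1 ->
  exists tau : F -> K, [/\ {morph tau : x y / x * y}, {in predC1 0 &, injective tau},
    forall y, y != 0 -> tau y ^+ #|F|.-1 = 1
    & forall x : K, x ^+ #|F|.-1 = 1 -> exists2 y, y != 0 & tau y = x].
Proof.
move=> MN; set s := #|F|.-1 in MN *.
have [ze hze] := exists_primitive_root MN.
have [z hz] := @exists_primitive_root F 1 s (mul1n _).
(* The default 0 is taken at y = 0 only, and keeps tau multiplicative there. *)
pose tau (y : F) : K := if [pick i : 'I_s | y == z ^+ i] is Some i then ze ^+ i else 0.
have s0 := prim_order_gt0 hz.
have z0 := root_of_unity_neq0 s0 (prim_expr_order hz).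
have tauE j : tau (z ^+ j) = ze ^+ j.
  rewrite /tau; case: pickP => [i /eqP E|/(_ (Ordinal (ltn_pmod j s0)))]; last first.
    by rewrite /= -(prim_expr_mod hz) eqxx.
  apply/eqP; rewrite (eq_prim_root_expr hze) -(eq_prim_root_expr hz) E eqxx //.
have tau_0 : tau 0 = 0.
  by rewrite /tau; case: pickP => // i /eqP/esym/eqP; rewrite expf_eq0 (negPf z0) andbF.
have log (y : F) : y != 0 -> exists j, y = z ^+ j.
  by move=> y0; have [i ->] := prim_rootP hz (expf_card_pred y0); exists i.
exists tau; split.
- move=> x y; have [->|/log[i ->]] := eqVneq x 0; first by rewrite !mul0r tau_0 mul0r.
  have [->|/log[j ->]] := eqVneq y 0; first by rewrite !mulr0 tau_0 mulr0.
  by rewrite -exprD !tauE exprD.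
- move=> x y; rewrite !inE => /log[i ->] /log[j ->]; rewrite !tauE => /eqP.
  by rewrite (eq_prim_root_expr hze) -(eq_prim_root_expr hz) => /eqP.
- by move=> y /log[j ->]; rewrite tauE -exprM mulnC exprM (prim_expr_order hze) expr1n.
- move=> x /(prim_rootP hze)[i ->]; exists (z ^+ i); rewrite ?tauE //.
  by rewrite expf_neq0.
Qed.

(** Take p^e elements with p > m prime and e a multiple of totient m: Euler's theorem gives m | p^e
    - 1, and p > 2 gives 2 != 0. The factor [B.+1] of e makes the field large. *)
Lemma exists_field (m B : nat) : (1 < m)%N ->
  exists F : finFieldType, [/\ 2%:R != 0 :> F, (B <= #|F|)%N & (m %| #|F|.-1)%N].
Proof.
move=> m1; have [p mp pr_p] := prime_above m.
have t0 : (0 < totient m * B.+1)%N by rewrite muln_gt0 totient_gt0 (ltnW m1).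
have [F chF cF] := PrimePowerField pr_p t0.
have co : coprime p m.
  by rewrite prime_coprime //; apply/negP=> /(dvdn_leq (ltnW m1)); rewrite leqNgt mp.
exists F; split.
- by rewrite -(dvdn_pcharf chF); apply/negP=> /(dvdn_leq (isT : (0 < 2)%N)); rewrite leqNgt (leq_ltn_trans m1 mp).
- rewrite cF; apply: leq_trans (ltnW (ltn_expl _ (prime_gt1 pr_p))).
  by apply: leq_trans (leq_pmull _ _); rewrite ?totient_gt0 ?(ltnW m1).
- rewrite cF -subn1 -eqn_mod_dvd; last by rewrite expn_gt0 prime_gt0.
  by rewrite expnM -modnXm (eqP (_ : p ^ totient m == 1 %[mod m])) ?modnXm ?exp1n //; apply/eqP/Euler_exp_totient.
Qed.

Lemma exists_injection (T T' : finType) : (#|T| <= #|T'|)%N -> exists f : T -> T', injective f.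
Proof.
move=> le; exists (fun x => enum_val (widen_ord le (enum_rank x))) => x y.
by move/enum_val_inj/(congr1 val) => /= /ord_inj/enum_rank_inj.
Qed.

(** * The action of the group on V x F *)

Section Action.
Variables (gT : finGroupType) (K F : finFieldType).
Local Notation V := 'rV[K]_#|{: gT}|.

Definition translp (g : gT) (x : V * F) : V * F := (transl g x.1, x.2).

Lemma translp_inj g : injective (translp g).
Proof.
move=> [v y] [v' y'] [E ->]; congr pair.
by rewrite -(translK g v) E translK.
Qed.

Lemma perm_translM : {morph (fun g => perm (@translp_inj g)) : g h / (g * h)%g}.
Proof.
by move=> g h; apply/permP=> x; rewrite permM !permE /translp /= translM.
Qed.

Lemma perm_transl_inj : injective (fun g => perm (@translp_inj g)).
Proof.
move=> g h E; apply: (@transl_faithful gT K) => v.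
by have := congr1 (fun s : {perm V * F} => (s (v, 0)).1) E; rewrite !permE.
Qed.

Lemma perm_translD g : {morph perm (@translp_inj g) : x y / x + y}.
Proof.
by move=> x y; rewrite !permE /translp /= translD.
Qed.

(** The block of (d, l) goes to that of (transl g d, l), admissible because col is invariant;
    vertical blocks are fixed. *)
Lemma perm_transl_family (col : V -> K) (tau : F -> K) (Base Pos : finType)
    (X : Base -> Pos -> K) (Y : Base -> Pos -> F) (Vert : {set {set F}}) g W :
  (forall g v, v != 0 -> col (transl g v) = col v) ->
  W \in family col tau X Y Vert -> perm (@translp_inj g) @: W \in family col tau X Y Vert.
Proof.
move=> colg /familyP[[b [d [l [d0 l0 cl ->]]]]|[C CV ->]].
  have -> : perm (@translp_inj g) @: base_block X Y b d l = base_block X Y b (transl g d) l.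
    by rewrite /base_block -imset_comp; apply: eq_imset => i; rewrite /= permE /translp /= translZ.
  by apply: base_block_family; rewrite ?transl_eq0 // colg.
have -> : perm (@translp_inj g) @: vertical K #|{: gT}| C = vertical K #|{: gT}| C; last exact: vertical_family.
rewrite /vertical -imset_comp; apply: eq_imset => y; rewrite /= permE /translp /=.
by congr pair; apply/eqP; rewrite transl_eq0.
Qed.

End Action.

Lemma design_with_regular_action (k : nat) (gT : finGroupType) (B : nat) : odd k -> (3 <= k)%N ->
  exists (T : finType) (Bs : {set {set T}}), [/\ (B < #|T|)%N, is_design #|T| k Bs
    & exists f : gT -> {perm T}, [/\ {morph f : g h / (g * h)%g}, injective f
        & forall g, f g \in design_aut Bs]].
Proof.
move=> k_odd k3; pose w := k./2.
have kE : k = w.*2.+1 by rewrite -[LHS]odd_double_half k_odd.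
have w0 : (0 < w)%N by move: k3; rewrite kE; case: (w).
pose n := #|{: 'I_w.*2.+1 * 'I_w}|.
have n0 : (0 < n)%N by rewrite /n card_prod !card_ord muln_gt0 w0.
have [Q1 HQ1] := field_difference_family (ltnW k3).
pose bd := ((2 * n + 1) + (2 * n + 1) * n * (2 * n + 1) * 2 + (2 * n + 1) * (2 * n + 1) * 2)%N.
have Ck : (0 < 'C(k, 2))%N by rewrite bin_gt0 ltnW.
(* F comes first. The divisor allows a vertical family with even exponent; the size gives [bd < s]
   for the greedy choice, and [k <= s]. *)
have [|F [F2 FQ dF]] := @exists_field (2 * 'C(k, 2)) (maxn Q1 (bd + k + 2)).
  by rewrite mulnC; move: Ck; case: 'C(k, 2).
have [FQ1 Fbd] : (Q1 <= #|F|)%N /\ (bd + k + 2 <= #|F|)%N by apply/andP; rewrite -geq_max.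
have [M1 EM1] := dvdnP dF.
have e1 : (M1 * 2 * 'C(k, 2))%N = #|F|.-1 by rewrite EM1 mulnA.
have e2 : ~~ odd (M1 * 2) by rewrite muln2 odd_double.
have [Vert Vert_df] := HQ1 F _ e1 e2 F2 FQ1.
pose s := #|F|.-1.
have sbd : (bd < s)%N by rewrite /s; move: Fbd; lia.
have ks : (k <= s)%N by rewrite /s; move: Fbd; lia.
have s_even : s = (s./2).*2.
  by rewrite -[LHS]odd_double_half /s EM1 oddM oddM andbF.
(* No truncation occurs, since 2 w < k <= s and s is even. *)
pose nu := (s./2 - w)%N.
have s_nu : s = ((w + nu).*2)%N.
  rewrite /nu subnKC -?s_even //; rewrite -leq_double -s_even; apply: leq_trans ks; by rewrite kE.
have [Q2 HQ2] := prescribed_differences_fin (Pos w) (n * s).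
(* K comes second, as [Q2] depends on n s. The divisor makes M even and a multiple of the group
   order; [B.+1] makes the point set large. *)
have [|K [K2 KQ dK]] := @exists_field (2 * #|{: gT}| * (n * s)) (maxn Q2 B.+1).
  have g0 : (0 < #|{: gT}|)%N by apply/card_gt0P; exists 1%g.
  have ns0 : (0 < n * s)%N by rewrite muln_gt0 n0 (leq_trans _ sbd).
  by rewrite -mulnA; apply: (leq_trans (n := 2)); rewrite ?leq_pmulr // muln_gt0 g0 ns0.
have [KQ2 KB] : (Q2 <= #|K|)%N /\ (B < #|K|)%N by apply/andP; rewrite -geq_max.
have [M2 EM2] := dvdnP dK.
pose M := (M2 * (2 * #|{: gT}|))%N.
have MN : (M * (n * s))%N = #|K|.-1 by rewrite EM2 /M !mulnA.
have M_even : ~~ odd M by rewrite /M !oddM andbF.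
have gM : (#|{: gT}| %| M)%N by rewrite /M mulnA dvdn_mull.
have [|tau [tauM tau_inj tau_root tau_surj]] := @exists_multiplicative_embedding K F (M * n).
  by rewrite -MN mulnA.
have [col [colZ colg col_root]] := exists_homogeneous_invariant MN gM.
have [|omega [omega_inj omegaE]] := @eq_card_bij _ _ [set: 'I_n] [set x : K | x ^+ n == 1] (1 : K).
  by rewrite cardsT card_ord (@card_roots_of_unity K (M * s) n) // -MN -mulnA [(s * n)%N]mulnC.
have omega1 p : omega p ^+ n = 1.
  have : omega p \in omega @: [set: 'I_n] by rewrite imset_f ?inE.
  by rewrite omegaE inE => /eqP.
have [b0 b0_inj] : exists f : 'I_n -> {y : F | y != 0}, injective f.
  apply: exists_injection; rewrite card_ord card_sig -[X in (_ <= X)%N]/#|predC1 (0 : F)| cardC1 -/s.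
  by apply: leq_trans (ltnW sbd); rewrite /bd -!addnA (leq_trans _ (leq_addr _ _)) // leq_pmull.
pose b p : F := val (b0 p).
have b_inj : injective b by move=> p p' /val_inj/b0_inj.
have b_neq0 p : b p != 0 by exact: valP (b0 p).
have [y y_inj] : exists f : Pos w -> F, injective f.
  by apply: exists_injection; rewrite card_Pos -kE (leq_trans ks) // leq_pred.
have cst_nz := level_factor_neq0 MN tau_root b.
have [a aP] := spread_exists MN K2 cst_nz omega1 sbd.
have omega_surj (x : K) : x ^+ n = 1 -> exists p, omega p = x.
  move=> x1; have : x \in omega @: [set: 'I_n] by rewrite omegaE inE x1.
  by case/imsetP=> p _ ->; exists p.
have om_inj : injective omega by move=> p p'; apply: omega_inj; rewrite inE.
have [X [Y [[X_inj X_flip Y_flip Y_eq] c_inj c_surj l_inj l_surj]]] :=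
  base_family_exists MN M_even K2 F2 tauM tau_inj tau_root b_inj b_neq0 aP s_nu w0
    (HQ2 K M MN KQ2) y_inj om_inj omega_surj.
pose Fam := family col tau X Y Vert.
have cPos : #|{: Pos w}| = k by rewrite card_Pos -kE.
exists ('rV[K]_#|{: gT}| * F)%type, (development Fam); split.
- rewrite card_prod card_mx mul1n; apply: leq_trans KB _.
  have g0 : (0 < #|{: gT}|)%N by apply/card_gt0P; exists 1%g.
  apply: (@leq_trans (#|K| ^ #|{: gT}|)%N); last by rewrite leq_pmulr // ltnW // finNzRing_gt1.
  by rewrite -{1}[#|K|]expn1 leq_pexp2l // ltnW // finNzRing_gt1.
- apply: development_design; exact: (family_difference_family MN M_even colZ col_root
    tauM tau_inj tau_root tau_surj cPos X_inj X_flip Y_flip Y_eq c_inj c_surj l_inj l_surj Vert_df).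
- exists (fun g => perm (@translp_inj gT K F g)); split.
  + exact: perm_translM.
  + exact: perm_transl_inj.
  + move=> g; apply: development_aut; first exact: perm_translD.
    by move=> W; apply: perm_transl_family.
Qed.

Local Close Scope ring_scope.

Theorem theorem1p2 (k : nat) (gT : finGroupType) (G : {group gT})
  (hk3 : 3 <= k) (hkodd : odd k)
  (hGeven : ~~ odd #|G|) (hkG : coprime k #|G|) :
  forall N : nat, exists2 v : nat, N < v &
    exists (T : finType) (Bs : {set {set T}}),
      is_design v k Bs /\
      exists2 H : {group {perm T}}, H \subset design_aut Bs & G \isog H.
Proof.
move=> N; have [T [Bs [NT dB [f [fM fI fA]]]]] := design_with_regular_action gT N hkodd hk3.
exists #|T|; first exact: NT.
exists T, Bs; split; first exact: dB.
exact: (isog_morphim_perm G fM fI fA).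
Qed.
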